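(* Assume that there are positive constants such that for all $x,y\in\mathbb{R}^d$: (i) $\mathbb{E}_\xi\|\tilde\nabla f(x,\xi)-\tilde\nabla f(y,\xi)\|^2\le\tilde L_{\nabla f}^2\|x-y\|^2$, $\mathbb{E}_\zeta\|\tilde\nabla c(x,\zeta)-\tilde\nabla c(y,\zeta)\|^2\le\tilde L_{\nabla c}^2\|x-y\|^2$, $\mathbb{E}_\zeta\|\tilde c(x,\zeta)-\tilde c(y,\zeta)\|^2\le\tilde L_c^2\|x-y\|^2$; (ii) $\mathbb{E}\|\tilde\nabla f(x,\xi)-\nabla f(x)\|^2\le\sigma_f^2$, $\mathbb{E}\|\tilde\nabla c(x,\zeta)-\nabla c(x)\|^2\le\sigma_{\nabla c}^2$, $\mathbb{E}\|\tilde c(x,\zeta)-c(x)\|^2\le\sigma_c^2$; (iii) $\|\nabla c(x)\|\le C_{\nabla c}$, $\|c(x)\|\le C_c$, $\|\tilde\nabla c(x,\zeta)\|\le\tilde C_{\nabla c}$, $\|\tilde c(x,\zeta)\|\le\tilde C_c$, $\|\nabla f(x)\|\le C_{\nabla f}$, $|f(x_k)|\le B_f$ for all iterates $x_k$, and $Q_\rho(x)\ge\underline Q>-\infty$ for all $\rho>0$ and all $x$; (iv) there is $\delta>0$ with $\mathrm{dist}(\nabla c(x_k)^\top c(x_k),-N_X(x_k))\ge\delta\|c(x_k)\|$ for all iterates $x_k$. Run the stochastic linearized quadratic penalty algorithm described in the context with $$\eta_k=\frac{1}{9\tilde L\rho(k+1)^{3/5}},\qquad \rho_k=\rho k^{1/5},\qquad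 \alpha_{k+1}=\frac{72}{81(k+1)^{4/5}},$$ for some constant $\rho>1$, where $\tilde L^2=4\tilde L_{\nabla f}^2+4m^2(\tilde C_c^2\tilde L_{\nabla c}^2+\tilde C_{\nabla c}^2\tilde L_c^2)$. Then there are constants $C,p>0$ independent of $\varepsilon$ such that for every $\varepsilon\in(0,1/2]$ there is an integer $K\le C\varepsilon^{-5}(\log(1/\varepsilon))^p$ (that is, $K=\widetilde O(\varepsilon^{-5})$) such that, with $\hat k$ selected uniformly at random from $\{1,\dots,K\}$ (independently of the run), there exists a (random) $\lambda\in\mathbb{R}^m$ with $$\mathbb{E}\,\mathrm{dist}\big(\nabla f(x_{\hat k+1})+\nabla c(x_{\hat k+1})^\top\lambda,\,-N_X(x_{\hat k+1})\big)\le\varepsilon,\qquad \mathbb{E}\|c(x_{\hat k+1})\|\le\varepsilon .$$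
   Context: Problem: $\min_{x\in X}f(x)$ subject to $c(x)=0$, where $X\subseteq\mathbb{R}^d$ is closed and convex, $f:\mathbb{R}^d\to\mathbb{R}$ and $c=(c_1,\dots,c_m)^\top:\mathbb{R}^d\to\mathbb{R}^m$ are smooth (Lipschitz gradients, possibly nonconvex), $f(x)=\mathbb{E}_\xi[\tilde f(x,\xi)]$, $c(x)=\mathbb{E}_\zeta[\tilde c(x,\zeta)]$. $\nabla c(x)\in\mathbb{R}^{m\times d}$ is the Jacobian, $\nabla c_i$ its rows viewed as gradients. Unbiased oracles $\tilde\nabla f(x,\xi)$ and $\tilde\nabla c(x,\zeta)$ (rows $\tilde\nabla c_i$) are given: $\mathbb{E}_\xi\tilde\nabla f(x,\xi)=\nabla f(x)$, $\mathbb{E}_\zeta\tilde\nabla c_i(x,\zeta)=\nabla c_i(x)$. $N_X(x)$ is the normal cone to $X$ at $x$, $P_X$ is projection onto $X$, $\mathrm{dist}(x,S)=\min_{y\in S}\|x-y\|$. Quadratic penalty function: $Q_\rho(x)=f(x)+\frac{\rho}{2}\sum_{i=1}^m c_i(x)^2$. Stochastic gradient: for $B=(\xi^0,\zeta^1,\zeta^2)$ with $\zeta^1,\zeta^2$ i.i.d., $\tilde\nabla Q_\rho(x,B)=\tilde\nabla f(x,\xi^0)+\rho\sum_{i=1}^m\tilde\nabla c_i(x,\zeta^1)\tilde c_i(x,\zeta^2)$. Algorithm: $x_1\in X$ arbitrary (deterministic), $g_1=\tilde\nabla Q_{\rho_1}(x_1,B_1)$. For $k=1,2,\dots$: $x_{k+1}=P_X(x_k-\eta_kg_k)$;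 draw a fresh independent sample $B_{k+1}=(\xi^0_{k+1},\zeta^1_{k+1},\zeta^2_{k+1})$; $g_{k+1}=\tilde\nabla Q_{\rho_{k+1}}(x_{k+1},B_{k+1})+(1-\alpha_{k+1})\big(g_k-\tilde\nabla Q_{\rho_k}(x_k,B_{k+1})\big)$. *)

(* Defs.v *)
From HB Require Import structures.
From mathcomp Require Import all_boot all_order all_algebra finmap.
From mathcomp Require Import all_classical all_reals all_analysis.

Set Implicit Arguments.
Unset Strict Implicit.
Unset Printing Implicit Defensive.

Import Order.TTheory GRing.Theory Num.Theory.
Import numFieldNormedType.Exports.

Local Open Scope classical_set_scope.
Local Open Scope ring_scope.

(* Vectors of R^n are row vectors 'rV[R]_n.  Hence the product J^T v of a
   transposed m x d Jacobian J with v in R^m is written v *m J. *)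

Section Geometry.
Context {R : realType}.

Definition dotv n (u v : 'rV[R]_n) : R := \sum_(i < n) u 0 i * v 0 i.

(* The library norm `|x| on matrices is the sup norm, hence this definition. *)
Definition enorm n (x : 'rV[R]_n) : R := Num.sqrt (\sum_(i < n) x 0 i ^+ 2).

(* Operator norm of v |-> A v induced by the Euclidean norms. *)
Definition opnorm m d (A : 'M[R]_(m, d)) : R :=
  sup [set enorm (v *m A^T) | v in [set v : 'rV[R]_d | enorm v <= 1]].

Definition dist n (x : 'rV[R]_n) (S : set 'rV[R]_n) : R :=
  inf [set enorm (x - y) | y in S].

Definition normal_cone n (X : set 'rV[R]_n) (x : 'rV[R]_n) : set 'rV[R]_n :=
  [set v | X x /\ forall y, X y -> dotv v (y - x) <= 0].

Definition neg_set n (S : set 'rV[R]_n) : set 'rV[R]_n := [set - v | v in S].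

(* xget returns the unique point satisfying the predicate when X is closed,
   convex and nonempty. *)
Definition proj n (X : set 'rV[R]_n) (x : 'rV[R]_n) : 'rV[R]_n :=
  xget 0 [set p | X p /\ forall y, X y -> enorm (x - p) <= enorm (x - y)].

Definition grad d (f : 'rV[R]_d -> R) (x : 'rV[R]_d) : 'rV[R]_d :=
  \row_(i < d) 'D_(delta_mx 0 i) f x.

(* The library Jacobian 'J c x acts on row vectors by right multiplication;
   its transpose is the m x d matrix whose i-th row is the gradient of c_i. *)
Definition jac d m (c : 'rV[R]_d -> 'rV[R]_m) (x : 'rV[R]_d) : 'M[R]_(m, d) :=
  ('J c x)^T.

Definition lipschitz_map d n (F : 'rV[R]_d -> 'rV[R]_n) : Prop :=
  exists L : R, forall x y, enorm (F x - F y) <= L * enorm (x - y).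

End Geometry.

Section Probability.
Context {R : realType}.

(* Borel sigma-algebra of R^n. *)
Definition borel_rV (n : nat) := g_sigma_algebraType (@open 'rV[R]_n).

Definition jointly_measurable_vec n k d (S : measurableType d)
    (F : 'rV[R]_n -> S -> 'rV[R]_k) : Prop :=
  forall j, measurable_fun [set: borel_rV n * S] (fun z => F z.1 z.2 0 j).

Definition jointly_measurable_mx n k l d (S : measurableType d)
    (F : 'rV[R]_n -> S -> 'M[R]_(k, l)) : Prop :=
  forall i j, measurable_fun [set: borel_rV n * S] (fun z => F z.1 z.2 i j).

Definition has_mean d (S : measurableType d) (P : probability S R)
    (Z : S -> R) (mean : R) : Prop :=
  P.-integrable [set: S] (EFin \o Z) /\ ('E_P[Z] = mean%:E)%E.

Definition has_law d d' (Om : measurableType d) (S : measurableType d')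
    (P : probability Om R) (Z : Om -> S) (mu : probability S R) : Prop :=
  measurable_fun [set: Om] Z /\
  forall A, measurable A -> P (Z @^-1` A) = mu A.

Definition indep2 d d1 d2 (Om : measurableType d) (S1 : measurableType d1)
    (S2 : measurableType d2) (P : probability Om R)
    (Y : Om -> S1) (Z : Om -> S2) : Prop :=
  forall A1 A2, measurable A1 -> measurable A2 ->
    (P (Y @^-1` A1 `&` Z @^-1` A2) = P (Y @^-1` A1) * P (Z @^-1` A2))%E.

Definition mutually_indep d d' (Om : measurableType d) (S : measurableType d')
    (P : probability Om R) (Z : nat -> Om -> S) : Prop :=
  forall (J : {fset nat}) (A : nat -> set S),
    (forall k, k \in J -> measurable (A k)) ->
    (P (\bigcap_(k in [set` J]) (Z k @^-1` A k)) =
     \prod_(k <- J) P (Z k @^-1` A k))%E.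

(* Uniform distribution on {1, ..., K} (K > 0), as the normalization of
   \d_1 + ... + \d_K; the last argument of mnormalize only matters for K = 0. *)
Definition unif1 (K : nat) : probability nat R :=
  mnormalize (msum (fun k => \d_(k.+1)) K) \d_1%N.

End Probability.

Section Algorithm.
Context {R : realType} {d m : nat} {dxi dzeta : measure_display}.
Context {Sxi : measurableType dxi} {Szeta : measurableType dzeta}.

Definition penalty (f : 'rV[R]_d -> R) (c : 'rV[R]_d -> 'rV[R]_m)
    (r : R) (x : 'rV[R]_d) : R :=
  f x + r / 2 * \sum_(i < m) c x 0 i ^+ 2.

(* A sample B = (xi0, zeta1, zeta2) is the left-nested triple. *)
Definition penalty_grad (Gf : 'rV[R]_d -> Sxi -> 'rV[R]_d)
    (Gc : 'rV[R]_d -> Szeta -> 'M[R]_(m, d))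
    (tc : 'rV[R]_d -> Szeta -> 'rV[R]_m)
    (r : R) (x : 'rV[R]_d) (B : Sxi * Szeta * Szeta) : 'rV[R]_d :=
  Gf x B.1.1 + r *: \sum_(i < m) tc x B.2 0 i *: row i (Gc x B.1.2).

(* Index 0 of all sequences is unused. *)
Definition slqp_run (X : set 'rV[R]_d)
    (Gf : 'rV[R]_d -> Sxi -> 'rV[R]_d)
    (Gc : 'rV[R]_d -> Szeta -> 'M[R]_(m, d))
    (tc : 'rV[R]_d -> Szeta -> 'rV[R]_m)
    (eta rho alpha : nat -> R) (x1 : 'rV[R]_d)
    (B : nat -> Sxi * Szeta * Szeta) (x g : nat -> 'rV[R]_d) : Prop :=
  [/\ x 1%N = x1,
      g 1%N = penalty_grad Gf Gc tc (rho 1%N) (x 1%N) (B 1%N) &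
      forall k, (1 <= k)%N ->
        x k.+1 = proj X (x k - eta k *: g k) /\
        g k.+1 = penalty_grad Gf Gc tc (rho k.+1) (x k.+1) (B k.+1)
          + (1 - alpha k.+1) *:
              (g k - penalty_grad Gf Gc tc (rho k) (x k) (B k.+1))].

Definition tildeL (mm : nat) (tLf tLgc tLc tCgc tCc : R) : R :=
  Num.sqrt (4 * tLf ^+ 2 +
    4 * mm%:R ^+ 2 * (tCc ^+ 2 * tLgc ^+ 2 + tCgc ^+ 2 * tLc ^+ 2)).

Definition step_eta (L rho : R) (k : nat) : R :=
  1 / (9 * L * rho * k.+1%:R `^ (3 / 5)).

Definition step_rho (rho : R) (k : nat) : R := rho * k%:R `^ (1 / 5).

(* To be used at k + 1, which gives 72 / (81 (k + 1)^(4/5)). *)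
Definition step_alpha (k : nat) : R := 72 / (81 * k%:R `^ (4 / 5)).

End Algorithm.

(* Main.v *)
From Pilot Require Import Defs.
From HB Require Import structures.
From mathcomp Require Import all_boot all_order all_algebra finmap.
From mathcomp Require Import all_classical all_reals all_analysis.
From mathcomp Require Import measurable_realfun ring lra.

(** The run is a projected gradient method on the penalty
    [Q_r = f + r/2 |c|^2], driven by the momentum estimator [g k] of the gradient
    of [Q_{rho_k}], with [rho_k = rho k^(1/5)]. Three quantities per iteration
    matter: the estimation error [err k = g k - grad Q_{rho_k} (x k)], the step
    [x k.+1 - x k], and the residual [resid k], the norm of the penalty gradient
    at [x k.+1] plus the normal vector left behind by the projection.

    Stationarity and feasibility both reduce to the residual. With the multiplier
    [lambda = rho_k c(x k.+1)] the residual bounds the distance in the first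
    conclusion ([dist_resid]). For the second one the regularity condition gives
    [delta rho_k |c(x k.+1)| <= Cgf + resid k] ([feasibility_resid]), and the
    growth of [rho_k] makes the average of [1 / rho_k] of order [K^(-1/5)].

    The mean squared residuals are bounded through the potential
    [E (Q_{rho_k} (x k) - Qlow) + weight k * E |err k|^2], where [weight k] is of
    order [k^(1/5)]. Descent along the step ([penalty_decrease]) pays
    [|step|^2 / eta] and costs [eta |err|^2]. The momentum recursion
    ([momentum_step]) contracts [E |err|^2] by [(1 - alpha)^2], and
    [weight * alpha] is of the order of [eta], so the contraction pays for this
    cost; the change of the estimated gradient costs
    [weight * rho_k^2 |step|^2], of the order of [|step|^2 / eta], which descent
    pays for. What remains is of order [1/k]: the fresh noise, because
    [weight * alpha^2 * rho_k^2 = O(1/k)], and the increase of the penalty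
    parameter, because [|c|] is itself controlled by the residual
    ([penalty_growth]). Using only that [|c|] is bounded, the latter term would
    be of order [k^(-4/5)] and the rate would be lost. Telescoping
    ([sum_sqr_resid]) gives [sum_k eta_k E (resid k)^2 = O(log K)], hence averages
    of order [log K / K^(1/5)] since [eta_K] is of order [K^(-3/5)]
    ([avg_resid], [avg_feas]), and [K] of order [(log(1/eps) / eps)^5] suffices
    ([choose_budget]).

    The momentum recursion needs the sample [B k.+1] to be independent of
    [(x k, g k)]. This pair is measurable for the sigma-algebra generated by the
    earlier samples ([run_measurable]), which a pi-system argument makes
    independent of [B k.+1] ([past_indep]); the conditional second moment is then
    computed with the past frozen ([momentum_inner], [mean_freeze_le]). *)

Set Implicit Arguments.
Unset Strict Implicit.
Unset Printing Implicit Defensive.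

Import Order.TTheory GRing.Theory Num.Theory.
Import numFieldNormedType.Exports.

Local Open Scope classical_set_scope.
Local Open Scope ring_scope.

(* Metric projection, as opposed to the coordinate projections of a product. *)
Local Notation proj := Pilot.Defs.proj.

(** * Euclidean geometry of row vectors *)

Section Euclidean.
Context {R : realType}.

Section Dot.
Context {n : nat}.
Implicit Types (u v w : 'rV[R]_n) (a : R).

Lemma rV_coordB u v j : (u - v) 0 j = u 0 j - v 0 j.
Proof. by rewrite !mxE. Qed.

Lemma rV_coordD u v j : (u + v) 0 j = u 0 j + v 0 j.
Proof. by rewrite mxE. Qed.

Lemma rV_coordZ a u j : (a *: u) 0 j = a * u 0 j.
Proof. by rewrite mxE. Qed.

Lemma dotvC u v : dotv u v = dotv v u.
Proof. by apply: eq_bigr => i _; rewrite mulrC. Qed.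

Lemma dotvDl u v w : dotv (u + v) w = dotv u w + dotv v w.
Proof.
by rewrite /dotv -big_split/=; apply: eq_bigr => i _; rewrite mxE mulrDl.
Qed.

Lemma dotvZl a u v : dotv (a *: u) v = a * dotv u v.
Proof.
by rewrite /dotv mulr_sumr; apply: eq_bigr => i _; rewrite mxE mulrA.
Qed.

Lemma dotvNl u v : dotv (- u) v = - dotv u v.
Proof. by rewrite -scaleN1r dotvZl mulN1r. Qed.

Lemma dotvNr u v : dotv u (- v) = - dotv u v.
Proof. by rewrite dotvC dotvNl dotvC. Qed.

Lemma dotvBl u v w : dotv (u - v) w = dotv u w - dotv v w.
Proof. by rewrite dotvDl dotvNl. Qed.

Lemma dotvDr u v w : dotv u (v + w) = dotv u v + dotv u w.
Proof. by rewrite dotvC dotvDl !(dotvC u). Qed.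

Lemma dotvZr a u v : dotv u (a *: v) = a * dotv u v.
Proof. by rewrite dotvC dotvZl dotvC. Qed.

Lemma dotvBr u v w : dotv u (v - w) = dotv u v - dotv u w.
Proof. by rewrite dotvC dotvBl !(dotvC u). Qed.

Lemma sqr_enorm_sum u : enorm u ^+ 2 = \sum_(i < n) u 0 i ^+ 2.
Proof. by rewrite sqr_sqrtr// sumr_ge0// => i _; rewrite sqr_ge0. Qed.

Lemma sqr_enorm u : enorm u ^+ 2 = dotv u u.
Proof. by rewrite sqr_enorm_sum; apply: eq_bigr => i _; rewrite expr2. Qed.

Lemma enorm_ge0 u : 0 <= enorm u.
Proof. exact: sqrtr_ge0. Qed.

Lemma enorm_eq0 u : enorm u = 0 -> u = 0.
Proof.
move=> u0; apply/rowP => i; rewrite mxE; apply/eqP; rewrite -sqrf_eq0.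
have : \sum_(i < n) u 0 i ^+ 2 == 0 by rewrite -sqr_enorm_sum u0 expr0n.
by rewrite psumr_eq0 => [/allP/(_ i)|? _]; [apply; rewrite mem_index_enum
  |rewrite sqr_ge0].
Qed.

Lemma enormZ a u : enorm (a *: u) = `|a| * enorm u.
Proof.
apply/eqP; rewrite -(@eqrXn2 _ 2)// ?mulr_ge0 ?enorm_ge0//.
by rewrite exprMn !sqr_enorm dotvZl dotvZr real_normK ?num_real// mulrA -expr2.
Qed.

Lemma enormN u : enorm (- u) = enorm u.
Proof. by rewrite -scaleN1r enormZ normrN1 mul1r. Qed.

Lemma enormBC u v : enorm (u - v) = enorm (v - u).
Proof. by rewrite -enormN opprB. Qed.

Lemma enorm0 : enorm (0 : 'rV[R]_n) = 0.
Proof. by rewrite -(scale0r 0) enormZ normr0 mul0r. Qed.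

Lemma sqr_enormD u v :
  enorm (u + v) ^+ 2 = enorm u ^+ 2 + 2 * dotv u v + enorm v ^+ 2.
Proof. by rewrite !sqr_enorm !(dotvDl, dotvDr) (dotvC v u); ring. Qed.

Lemma dotv_le_enorm u v : dotv u v <= enorm u * enorm v.
Proof.
have [u0|u0] := eqVneq (enorm u) 0.
  by rewrite (enorm_eq0 u0) enorm0 mul0r -(scale0r 0) dotvZl mul0r.
have [v0|v0] := eqVneq (enorm v) 0.
  by rewrite (enorm_eq0 v0) enorm0 mulr0 -(scale0r 0) dotvZr mul0r.
have uv0 : 0 < enorm u * enorm v by rewrite mulr_gt0// lt_def ?u0 ?v0 enorm_ge0.
have := sqr_ge0 (enorm (enorm v *: u + (- enorm u) *: v)).
rewrite sqr_enormD !enormZ dotvZl dotvZr normrN !ger0_norm ?enorm_ge0//.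
rewrite (_ : _ + _ + _ = 2 * (enorm u * enorm v) *
  (enorm u * enorm v - dotv u v)); last by ring.
by rewrite pmulr_rge0 ?subr_ge0// pmulr_rgt0.
Qed.

Lemma enormD u v : enorm (u + v) <= enorm u + enorm v.
Proof.
rewrite -ler_sqr ?nnegrE ?addr_ge0 ?enorm_ge0// sqr_enormD.
have := dotv_le_enorm u v; lra.
Qed.

Lemma enormB u v : enorm (u - v) <= enorm u + enorm v.
Proof. by rewrite -(enormN v) enormD. Qed.

Lemma sqr_enormD_le u v :
  enorm (u + v) ^+ 2 <= 2 * enorm u ^+ 2 + 2 * enorm v ^+ 2.
Proof.
have := enormD u v; have := enorm_ge0 (u + v).
have := sqr_ge0 (enorm u - enorm v); nra.
Qed.

Lemma normr_le_enorm u i : `|u 0 i| <= enorm u.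
Proof.
rewrite -ler_sqr ?nnegrE ?enorm_ge0// sqr_enorm_sum real_normK ?num_real//.
by rewrite (bigD1 i)//= lerDl sumr_ge0// => j _; rewrite sqr_ge0.
Qed.

Lemma norm_le_enorm u : `|u| <= enorm u.
Proof.
rewrite [leLHS]/Num.Def.normr/= mx_normrE (bigmax_le _ (enorm_ge0 u))//= => -[i
  j] _ /=.
by rewrite (ord1 i) normr_le_enorm.
Qed.

Lemma enorm_le_norm u : enorm u <= Num.sqrt n%:R * `|u|.
Proof.
rewrite -ler_sqr ?nnegrE ?enorm_ge0 ?mulr_ge0 ?sqrtr_ge0//.
rewrite exprMn sqr_enorm_sum sqr_sqrtr//.
rewrite -[X in X%:R * _]card_ord -sum1_card natr_sum mulr_suml ler_sum// => i _.
rewrite mul1r -(real_normK (num_real (u 0 i))) ler_sqr ?nnegrE//.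
by rewrite [leRHS]/Num.Def.normr/= mx_normrE (le_bigmax _ _ (0, i)).
Qed.

End Dot.

(** Lipschitz maps for the Euclidean norm are continuous for the topology of
    the sup norm, because the two norms are equivalent. *)
Lemma enorm_lipschitz_continuous n (F : 'rV[R]_n -> R) (L : R) :
  (forall x y, `|F x - F y| <= L * enorm (x - y)) -> continuous F.
Proof.
move=> lipF x; apply: (iffRL (@cvgrPdist_le _ _ _ (nbhs x) _ _ _)) => e e0.
pose s := `|L| * Num.sqrt n%:R + 1.
have s0 : 0 < s by rewrite ltr_wpDl// mulr_ge0// sqrtr_ge0.
near=> y.
apply: (le_trans (lipF _ _)).
apply: (@le_trans _ _ (s * `|x - y|)).
  apply: (@le_trans _ _ (`|L| * (Num.sqrt n%:R * `|x - y|))).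
    apply: (@le_trans _ _ (`|L| * enorm (x - y))).
      by rewrite ler_wpM2r ?enorm_ge0 ?ler_norm.
    by rewrite ler_wpM2l ?enorm_le_norm.
  by rewrite mulrA ler_wpM2r// lerDl.
rewrite -ler_pdivlMl// mulrC; near: y.
by apply: cvgr_dist_le; [exact: cvg_id|exact: divr_gt0].
Unshelve. all: by end_near. Qed.

Lemma continuous_enorm n : continuous (@enorm R n).
Proof.
apply: (@enorm_lipschitz_continuous _ _ 1) => x y; rewrite mul1r.
have := enormD (x - y) y; have := enormD (y - x) x; rewrite !subrK (enormBC y).
by move=> ? ?; rewrite ler_norml; apply/andP; split; lra.
Qed.

Lemma coord_lipschitz_continuous n k (F : 'rV[R]_n -> 'rV[R]_k) (L : R) j :
  (forall x y, enorm (F x - F y) <= L * enorm (x - y)) ->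
  continuous (fun x => F x 0 j).
Proof.
move=> lipF; apply: (@enorm_lipschitz_continuous _ _ L) => x y.
by rewrite -rV_coordB (le_trans (normr_le_enorm _ _)).
Qed.



(** Cauchy-Schwarz in every column. Unlike the operator norm, the right-hand side
    is visibly a measurable function of the matrix. *)
Lemma sqr_enorm_mulmx m d (v : 'rV[R]_m) (A : 'M[R]_(m, d)) :
  enorm (v *m A) ^+ 2 <= enorm v ^+ 2 * \sum_(i < m) enorm (row i A) ^+ 2.
Proof.
under [in leRHS]eq_bigr do rewrite sqr_enorm_sum.
rewrite exchange_big/= mulr_sumr sqr_enorm_sum ler_sum// => j _.
pose w := (col j A)^T.
have -> : (v *m A) 0 j = dotv v w.
  by rewrite mxE; apply: eq_bigr => i _; rewrite !mxE.
have -> : \sum_(i < m) row i A 0 j ^+ 2 = enorm w ^+ 2.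
  by rewrite sqr_enorm_sum; apply: eq_bigr => i _; rewrite !mxE.
rewrite -exprMn -(real_normK (num_real (dotv v w))) ler_sqr ?nnegrE
  ?mulr_ge0 ?enorm_ge0// ler_norml dotv_le_enorm andbT lerNl -dotvNl.
by rewrite (le_trans (dotv_le_enorm _ _))// enormN.
Qed.

Section Operator.
Context {m d : nat}.
Implicit Types (A : 'M[R]_(m, d)).

Lemma opnorm_has_sup A :
  has_sup [set enorm (v *m A^T) | v in [set v : 'rV[R]_d | enorm v <= 1]].
Proof.
split; first by exists (enorm ((0 : 'rV[R]_d) *m A^T)), 0 => //=;
  rewrite enorm0.
exists (Num.sqrt (\sum_(i < d) enorm (row i A^T) ^+ 2)) => _ [u /= u1 <-].
rewrite -ler_sqr ?nnegrE ?enorm_ge0 ?sqrtr_ge0//.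
rewrite [leRHS]sqr_sqrtr ?sumr_ge0// => [|i _]; last by rewrite sqr_ge0.
apply: (le_trans (sqr_enorm_mulmx _ _)); rewrite ler_piMl//.
  by rewrite sumr_ge0// => i _; rewrite sqr_ge0.
by rewrite exprn_ile1 ?enorm_ge0.
Qed.

Lemma opnorm_ge0 A : 0 <= opnorm A.
Proof.
apply: (le_trans (enorm_ge0 ((0 : 'rV[R]_d) *m A^T))).
apply: ub_le_sup; first by have [] := opnorm_has_sup A.
exists 0 => //=; rewrite enorm0; exact: ler01.
Qed.

Lemma enorm_mulmx_tr_le (v : 'rV[R]_d) A :
  enorm (v *m A^T) <= enorm v * opnorm A.
Proof.
have [v0|v0] := eqVneq (enorm v) 0.
  by rewrite (enorm_eq0 v0) mul0mx !enorm0 mul0r.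
rewrite mulrC -ler_pdivrMr; last by rewrite lt_def v0 enorm_ge0.
rewrite mulrC -{1}(ger0_norm (enorm_ge0 v)) -normfV -enormZ scalemxAl.
apply: ub_le_sup; first by have [] := opnorm_has_sup A.
exists ((enorm v)^-1 *: v) => //=.
by rewrite enormZ normfV ger0_norm ?enorm_ge0// mulVf.
Qed.

(** The operator norm in force is that of [v |-> A v]; the transposed map has
    the same norm, because [|uA|^2 = <u, (uA) A^T>]. *)
Lemma enorm_mulmx_le (u : 'rV[R]_m) A : enorm (u *m A) <= enorm u * opnorm A.
Proof.
have [v0|v0] := eqVneq (enorm (u *m A)) 0.
  by rewrite v0 mulr_ge0 ?enorm_ge0 ?opnorm_ge0.
have {}v0 : 0 < enorm (u *m A) by rewrite lt_def v0 enorm_ge0.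
rewrite -(ler_pM2r v0) -expr2 sqr_enorm.
have -> : dotv (u *m A) (u *m A) = dotv u ((u *m A) *m A^T).
  have E k (a b : 'rV[R]_k) : dotv a b = (a *m b^T) 0 0.
    by rewrite mxE; apply: eq_bigr => i _; rewrite mxE.
  by rewrite !E [in RHS]trmx_mul trmxK mulmxA.
apply: (le_trans (dotv_le_enorm _ _)).
by rewrite -mulrA ler_wpM2l ?enorm_ge0// mulrC enorm_mulmx_tr_le.
Qed.

Lemma enorm_row_le i A : enorm (row i A) <= opnorm A.
Proof.
rewrite rowE (le_trans (enorm_mulmx_le _ _))// ler_piMl ?opnorm_ge0//.
rewrite -ler_sqr ?nnegrE ?enorm_ge0// sqr_enorm_sum (bigD1 i)//= big1.
  by rewrite !mxE !eqxx expr1n addr0.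
by move=> j ji; rewrite !mxE (negbTE ji) andbF expr0n.
Qed.

End Operator.
End Euclidean.

(** * Projection onto a closed convex set and the normal cone *)

Section Projection.
Context {R : realType} {n : nat} (X : set 'rV[R]_n).
Hypothesis (closedX : closed X) (convexX : convex_set X).
Context (x0 : 'rV[R]_n) (Xx0 : X x0).

(** A nearest point exists by compactness: it may be searched among the points
    that are at least as close to [z] as [x0]. *)
Lemma proj_nearest (z : 'rV[R]_n) :
  X (proj X z) /\ forall y, X y -> enorm (z - proj X z) <= enorm (z - y).
Proof.
apply: (@xgetPex _ 0 [set p | X p /\ forall y, X y ->
  enorm (z - p) <= enorm (z - y)]).
pose h (y : 'rV[R]_n) := enorm (z - y).
have ch : continuous h.
  move=> y; apply: (@continuous_comp _ _ _ (fun y : 'rV[R]_n => z - y) (@enorm R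
    n) y);
    last exact: continuous_enorm.
  by apply: continuousB; [exact: cst_continuous|].
pose A := X `&` [set y | h y <= h x0].
have clA : closed A.
  by apply: closedI => //; exact: (preimage_closed (fun y _ => ch y) (@closed_le
    R (h x0))).
have bA : bounded_set A.
  exists (enorm z + h x0); split; first exact: num_real.
  move=> M hM y [_ /= yh].
  rewrite (le_trans (norm_le_enorm y))// (le_trans _ (ltW hM))//.
  rewrite (_ : y = z - (z - y)) ?(le_trans (enormB _ _))// ?lerD2l//.
  by rewrite opprB addrC subrK.
have A0 : A !=set0 by exists x0; split => //=.
have [p] := EVT_min_rV A0 (bounded_closed_compact bA clA)
  (continuous_subspaceT ch).
rewrite inE => -[Xp hp] minp; exists p; split => // y Xy.
have [yx0|/ltW x0y] := leP (h y) (h x0); last exact: le_trans hp x0y.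
by apply: minp; rewrite inE.
Qed.

Lemma proj_mem (z : 'rV[R]_n) : X (proj X z).
Proof. by have [] := proj_nearest z. Qed.

(** Moving from the projection [p] towards [y] by a fraction [t] changes the
    squared distance to [z] by [- 2 t <z - p, y - p> + O(t^2)], which cannot be
    negative for small [t]. *)
Lemma proj_obtuse (z y : 'rV[R]_n) :
  X y -> dotv (z - proj X z) (y - proj X z) <= 0.
Proof.
move=> Xy; have [Xp minp] := proj_nearest z; move: Xp minp.
set p := proj X z => Xp minp.
rewrite leNgt; apply/negP; set D := dotv _ _ => D0.
pose N := enorm (y - p) ^+ 2.
have N0 : 0 <= N by exact: sqr_ge0.
pose t := D / (D + N).
have DN : 0 < D + N by lra.
have t0 : 0 < t by exact: divr_gt0.
have t1 : t <= 1 by rewrite ler_pdivrMr// mul1r lerDl.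
have := @convexX y p (Itv01 (ltW t0) t1).
rewrite !inE => /(_ Xy Xp) /minp.
rewrite [X in _ <= enorm X -> _](_ : _ = (z - p) + (- t) *: (y - p));
  last first.
  by apply/rowP => i; rewrite !mxE /= /unstable.onem; ring.
rewrite -ler_sqr ?nnegrE ?enorm_ge0// (sqr_enormD (z - p)) dotvZr -/D enormZ
  normrN.
rewrite exprMn -/N real_normK ?num_real// => h.
have tN : t * N <= D.
  by rewrite mulrAC ler_pdivrMr// ler_wpM2l ?ltW//; lra.
have : 0 <= t * (t * N - 2 * D) by lra.
by rewrite pmulr_rge0//; lra.
Qed.

Lemma proj_nonexpansive (z z' : 'rV[R]_n) :
  enorm (proj X z - proj X z') <= enorm (z - z').
Proof.
have h1 := proj_obtuse z (proj_mem z').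
have h2 := proj_obtuse z' (proj_mem z).
set p := proj X z in h1 h2 *; set q := proj X z' in h1 h2 *.
have [->|pq] := eqVneq (enorm (p - q)) 0; first exact: enorm_ge0.
have {}pq : 0 < enorm (p - q) by rewrite lt_def pq enorm_ge0.
rewrite -(ler_pM2r pq) (le_trans _ (dotv_le_enorm _ _))// -expr2 sqr_enorm.
move: h1 h2; rewrite !(dotvBl, dotvBr) (dotvC q p).
by move: (dotv z q) (dotv z p) (dotv p q) (dotv p p) (dotv z' p) (dotv z' q)
  (dotv q q) => *; lra.
Qed.

Lemma continuous_proj_coord j : continuous (fun z => proj X z 0 j).
Proof.
by apply: (@coord_lipschitz_continuous _ _ _ _ 1) => z z';
  rewrite mul1r proj_nonexpansive.
Qed.

(** The obtuse angle at the projection says that what a projected gradient step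
    loses is a normal vector. *)
Lemma proj_step_normal (y g : 'rV[R]_n) (eta : R) : 0 < eta ->
  normal_cone X (proj X (y - eta *: g))
    (eta^-1 *: (y - proj X (y - eta *: g)) - g).
Proof.
move=> eta0; split; first exact: proj_mem.
move=> u Xu; have := proj_obtuse (y - eta *: g) Xu.
set p := proj _ _ => h.
have -> : eta^-1 *: (y - p) - g = eta^-1 *: (y - eta *: g - p).
  by rewrite [in RHS]addrAC [in RHS]scalerBr scalerA mulVf ?gt_eqF// scale1r.
by rewrite dotvZl pmulr_rle0 ?invr_gt0.
Qed.

End Projection.

Section NormalCone.
Context {R : realType} {n : nat}.
Implicit Types (x u v : 'rV[R]_n) (X S : set 'rV[R]_n).

Lemma dist_ge0 x S : 0 <= dist x S.
Proof.
rewrite /dist; have [->|S0] := eqVneq [set enorm (x - y) | y in S] set0.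
  by rewrite inf0.
by apply: lb_le_inf; [exact/set0P|move=> _ [y _ <-]; exact: enorm_ge0].
Qed.

Lemma dist_le x v S : S v -> dist x S <= enorm (x - v).
Proof.
by move=> Sv; apply: ge_inf; [exists 0 => _ [y _ <-];
  exact: enorm_ge0|exists v].
Qed.

Lemma normal_coneZ X x u (a : R) : 0 <= a ->
  normal_cone X x u -> normal_cone X x (a *: u).
Proof.
by move=> a0 [Xx h]; split => // y /h; rewrite dotvZl; exact: mulr_ge0_le0.
Qed.

Lemma dist_neg_normal_le X x u v :
  normal_cone X x u -> dist v (neg_set (normal_cone X x)) <= enorm (v + u).
Proof.
by move=> Nu; rewrite (le_trans (@dist_le _ (- u) _ _))//;
  [exists u|rewrite opprK].
Qed.

End NormalCone.

(** * The quadratic penalty and its gradient *)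

Section Penalty.
Context {R : realType} {d m : nat}.
Context (f : 'rV[R]_d -> R) (c : 'rV[R]_d -> 'rV[R]_m).

Definition grad_penalty (r : R) (x : 'rV[R]_d) : 'rV[R]_d :=
  grad f x + r *: (c x *m jac c x).

Hypothesis f_diff : forall x, differentiable f x.
Hypothesis c_diff : forall x, differentiable c x.

Lemma derive_grad (x v : 'rV[R]_d) : 'D_v f x = dotv (grad f x) v.
Proof.
rewrite deriveE// [in LHS](row_sum_delta v) linear_sum; apply: eq_bigr => i _.
by rewrite linearZ/= -deriveE// mxE mulrC.
Qed.

Lemma is_derive_penalty (r : R) (x v : 'rV[R]_d) :
  is_derive x v (penalty f c r) (dotv (grad_penalty r x) v).
Proof.
pose ci i := fun y : 'rV[R]_d => c y 0 i.
have dc : derivable c x v by exact: diff_derivable.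
have dci i : is_derive x v (ci i) ((v *m (jac c x)^T) 0 i).
  split; first exact: (derivable_mxP c x v).1.
  by rewrite trmxK -deriveEjacobian// derive_mx// mxE.
have df : is_derive x v f (dotv (grad f x) v).
  by split; [exact: diff_derivable|exact: derive_grad].
have -> : penalty f c r = f + (r / 2) *: \sum_(i < m) (ci i ^+ 2).
  by apply/funext => y; rewrite /penalty fctE/= fct_sumE.
have dS := is_derive_sum (fun i => is_deriveX 2 (dci i)).
apply: (@is_derive_eq _ _ _ _ _ _ _ _ (is_deriveD df (is_deriveZ (r / 2) dS))).
rewrite dotvDl dotvZl; congr (_ + _).
have -> : dotv (c x *m jac c x) v = dotv (c x) (v *m (jac c x)^T).
  have E k (a b : 'rV[R]_k) : dotv a b = (a *m b^T) 0 0.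
    by rewrite mxE; apply: eq_bigr => i _; rewrite mxE.
  by rewrite !E trmx_mul trmxK mulmxA.
rewrite /GRing.scale/= /dotv !mulr_sumr; apply: eq_bigr => i _.
by rewrite /ci expr1 /GRing.scale/=; field.
Qed.

(* Along the line the difference quotients are literally those defining the
   directional derivative at [x + s *: v]. *)
Lemma is_derive_penalty_line (r : R) (x v : 'rV[R]_d) (s : R) :
  is_derive s 1 (fun t : R => penalty f c r (x + t *: v))
    (dotv (grad_penalty r (x + s *: v)) v).
Proof.
have [dF <-] := is_derive_penalty r (x + s *: v) v.
have E : (fun h : R => h^-1 *: (((fun t : R => penalty f c r (x + t *: v)) \o
      shift s) (h *: 1) - penalty f c r (x + s *: v))) =
    (fun h : R => h^-1 *: ((penalty f c r \o shift (x + s *: v)) (h *: v) -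
      penalty f c r (x + s *: v))).
  apply/funext => h /=; congr (_ *: (penalty f c r _ - _)).
  by rewrite scalerDl [h *: 1]mulr1 addrCA.
split; first by rewrite /derivable E.
by rewrite /derive E.
Qed.

(** By the mean value theorem the increment is [<grad Q z, y - x>] for some [z]
    between [x] and [y], and [z] is no farther from [x] than [y] is. *)
Lemma penalty_descent (r L : R) (x y : 'rV[R]_d) : 0 <= L ->
  (forall u v, enorm (grad_penalty r u - grad_penalty r v) <= L * enorm (u - v))
    ->
  penalty f c r y <=
    penalty f c r x + dotv (grad_penalty r x) (y - x) + L * enorm (y - x) ^+ 2.
Proof.
move=> L0 lipG; pose v := y - x.
pose phi := fun t : R => penalty f c r (x + t *: v).
have dphi (t : R) : is_derive t (1 : R) phi (dotv (grad_penalty r (x + t *: v))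
  v).
  exact: is_derive_penalty_line.
have cphi : {within `[0, 1], continuous phi}.
  apply: derivable_within_continuous => t _.
  by have [] := dphi t.
have [z zx ->] : exists2 z, enorm (z - x) <= enorm v &
    penalty f c r y = penalty f c r x + dotv (grad_penalty r z) v.
  have [t tI E] := MVT ltr01 (fun t _ => dphi t) cphi.
  exists (x + t *: v).
    rewrite addrC addKr enormZ; move: tI; rewrite in_itv/= => /andP[t0 t1].
    by rewrite ger0_norm ?(ltW t0)// ler_piMl ?enorm_ge0// ltW.
  move: E; rewrite subr0 mulr1 /phi scale1r scale0r addr0.
  have -> : x + v = y by rewrite /v addrC subrK.
  by move=> <-; rewrite addrC subrK.
have : dotv (grad_penalty r z - grad_penalty r x) v <= L * enorm v ^+ 2.
  apply: (le_trans (dotv_le_enorm _ _)).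
  rewrite [X in _ <= _ * X]expr2 mulrA; apply: ler_wpM2r;
    first exact: enorm_ge0.
  by apply: (le_trans (lipG _ _)); apply: ler_wpM2l.
rewrite (dotvBl (grad_penalty r z) (grad_penalty r x) v).
by move=> h; rewrite -[leRHS]addrA lerD2l -lerBlDl.
Qed.

End Penalty.

(** * Means of real random variables *)

(** The integral of a nonnegative function is a supremum over the simple
    functions below it, so it is monotone even for functions that are not
    measurable, such as the distance to a moving normal cone. *)
Lemma ge0_le_integral_nonmeasurable d (T : measurableType d) (R : realType)
    (mu : {measure set T -> \bar R}) (f g : T -> \bar R) :
  (forall t, 0 <= f t)%E -> (forall t, f t <= g t)%E ->
  (\int[mu]_t f t <= \int[mu]_t g t)%E.
Proof.
move=> f0 fg; have g0 t : (0 <= g t)%E by exact: le_trans (fg t).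
rewrite !ge0_integralTE//; apply: ereal_sup_le => _ [h /= hf <-].
by exists h => //= t; exact: le_trans (fg t).
Qed.

Section Mean.
Context {dO} {Om : measurableType dO} {R : realType} (P : probability Om R).
Implicit Types (f g h : Om -> R) (a b : R).

Definition L1 h := P.-integrable [set: Om] (EFin \o h).

(** Real-valued; [fine] sends an infinite integral to 0, so statements about
    [mean] go together with [L1]. *)
Definition mean h : R := fine (\int[P]_w (h w)%:E).

Lemma mean_EFin h : L1 h -> (\int[P]_w (h w)%:E)%E = (mean h)%:E.
Proof. by move=> Lh; rewrite fineK//; exact: integrable_fin_num. Qed.

Lemma L1_measurable h : L1 h -> measurable_fun [set: Om] h.
Proof. by move=> /measurable_int /measurable_EFinP. Qed.

Lemma L1_cst a : L1 (fun=> a).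
Proof. exact: finite_measure_integrable_cst. Qed.

Lemma mean_cst a : mean (fun=> a) = a.
Proof.
by rewrite /mean integral_cst//= [P _]probability_setT mule1.
Qed.

Lemma L1D f g : L1 f -> L1 g -> L1 (fun w => f w + g w).
Proof. by move=> Lf Lg; have := integrableD measurableT Lf Lg. Qed.

Lemma meanD f g : L1 f -> L1 g -> mean (fun w => f w + g w) = mean f + mean g.
Proof.
move=> Lf Lg; rewrite /mean; under eq_integral do rewrite EFinD.
by rewrite integralD//= fineD//; exact: integrable_fin_num.
Qed.

Lemma L1Z a f : L1 f -> L1 (fun w => a * f w).
Proof. by move=> Lf; have := integrableZl measurableT a Lf. Qed.

Lemma meanZ a f : L1 f -> mean (fun w => a * f w) = a * mean f.
Proof.
move=> Lf; rewrite /mean; under eq_integral do rewrite EFinM.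
by rewrite integralZl//= fineM//; exact: integrable_fin_num.
Qed.

Lemma L1B f g : L1 f -> L1 g -> L1 (fun w => f w - g w).
Proof. by move=> Lf Lg; have := integrableB measurableT Lf Lg. Qed.

Lemma meanB f g : L1 f -> L1 g -> mean (fun w => f w - g w) = mean f - mean g.
Proof.
move=> Lf Lg; have := meanD Lf (L1Z (-1) Lg); rewrite meanZ// mulN1r => <-.
by congr mean; apply/funext => w; rewrite mulN1r.
Qed.

Lemma L1_sum n (F : 'I_n -> Om -> R) :
  (forall i, L1 (F i)) -> L1 (fun w => \sum_(i < n) F i w).
Proof.
move=> LF; elim: n F LF => [|n ih] F LF.
  by under eq_fun do rewrite big_ord0; exact: L1_cst.
by under eq_fun do rewrite big_ord_recl; apply: L1D => //; exact: ih.
Qed.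

Lemma mean_sum n (F : 'I_n -> Om -> R) : (forall i, L1 (F i)) ->
  mean (fun w => \sum_(i < n) F i w) = \sum_(i < n) mean (F i).
Proof.
move=> LF; elim: n F LF => [|n ih] F LF.
  by under eq_fun do rewrite big_ord0; rewrite mean_cst big_ord0.
under eq_fun do rewrite big_ord_recl.
by rewrite meanD// ?ih ?big_ord_recl//; exact: L1_sum.
Qed.

Lemma mean_ge0 f : (forall w, 0 <= f w) -> 0 <= mean f.
Proof. by move=> f0; rewrite fine_ge0// integral_ge0// => w _;
  rewrite lee_fin. Qed.

Lemma mean_le f g : L1 f -> L1 g -> {ae P, forall w, f w <= g w} ->
  mean f <= mean g.
Proof.
move=> Lf Lg fg; have LB := L1B Lg Lf.
rewrite -subr_ge0 -meanB//.
(* almost surely equal to the difference, but nonnegative everywhere *)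
pose p w := Num.max (g w - f w) 0.
have -> : mean (fun w => g w - f w) = mean p.
  congr fine; apply: ae_eq_integral => //.
  - exact: measurable_int LB.
  - apply/measurable_EFinP; apply: measurable_maxr => //.
    exact: L1_measurable LB.
  - case: fg => N [mN N0 sub]; exists N; split => // w /= h;
    apply: sub => /= fgw.
    by apply: h => _; rewrite /p max_l// subr_ge0.
by apply: mean_ge0 => w; rewrite /p le_max lexx orbT.
Qed.

Lemma L1_of_le h a : measurable_fun [set: Om] h -> (forall w, 0 <= h w) ->
  (\int[P]_w (h w)%:E <= a%:E)%E -> L1 h /\ mean h <= a.
Proof.
move=> mh h0 ha; have Lh : L1 h.
  apply/integrableP; split; first exact/measurable_EFinP.
  under eq_integral => w _ do rewrite /= ger0_norm//.
  by rewrite (le_lt_trans ha)// ltry.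
by split => //; rewrite -lee_fin -mean_EFin.
Qed.

Lemma L1_le f g : measurable_fun [set: Om] f -> L1 g ->
  {ae P, forall w, `|f w| <= g w} -> L1 f.
Proof.
move=> mf Lg fg; apply/integrableP; split; first exact/measurable_EFinP.
have /integrableP[mg] := Lg; apply: le_lt_trans.
apply: ae_ge0_le_integral => //.
- by do 2 apply: measurableT_comp => //.
- by do 2 apply: measurableT_comp => //.
case: fg => N [mN N0 sub]; exists N; split => // w /= h; apply: sub => /= fgw.
by apply: h => _; rewrite lee_fin (le_trans fgw)// ler_norm.
Qed.

Lemma L1_bounded f a : measurable_fun [set: Om] f ->
  {ae P, forall w, `|f w| <= a} -> L1 f.
Proof. by move=> mf fa; apply: (L1_le mf (L1_cst a)). Qed.

End Mean.

(** * Borel measurability of vector-valued maps *)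

Section Borel.
Context {R : realType} {n : nat}.

(** Every open set is a countable union of sup-norm balls with rational
    centres and radii, and such a ball is a finite intersection of conditions
    on single coordinates. *)
Lemma measurable_rV d (T : measurableType d) (F : T -> 'rV[R]_n) :
  (forall j, measurable_fun [set: T] (fun t => F t 0 j)) ->
  measurable_fun [set: T] (F : T -> borel_rV n).
Proof.
move=> mF; apply: (@measurability _ _ T (borel_rV n) setT F (@open 'rV[R]_n)) =>
  // _ [U oU <-].
rewrite setTI.
pose ctr (q : 'rV[rat]_n) : 'rV[R]_n := \row_j ratr (q 0 j).
pose good (p : 'rV[rat]_n * nat) := ball (ctr p.1) p.2.+1%:R^-1 `<=` U.
(* [bx] is empty for the rational balls that are not inside [U] *)
pose bx (p : 'rV[rat]_n * nat) := if `[< good p >]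
  then \bigcap_(j in [set: 'I_n])
    ((fun t => F t 0 j) @^-1` ball (ctr p.1 0 j) p.2.+1%:R^-1)
  else set0.
have -> : F @^-1` U = \bigcup_p bx p.
  apply/seteqP; split => t /=.
    move=> Ut.
    have /nbhs_ballP[e /= e0 eU] : nbhs (F t) U by exact: open_nbhs_nbhs.
    have [k ke] : exists k, k.+1%:R^-1 < e / 2.
      have [k _ /(_ _ (leqnn _)) hk] := near_infty_natSinv_lt (PosNum (divr_gt0
        e0 (ltr0n R 2))).
      by exists k.
    have k0 : 0 < k.+1%:R^-1 :> R by rewrite invr_gt0.
    have qP j : exists q : rat, ball (ratr q : R) k.+1%:R^-1 (F t 0 j).
      have [q] : exists q : rat, ratr q \in `](F t 0 j - k.+1%:R^-1), (F t 0 j +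
        k.+1%:R^-1)[.
        by apply: rat_in_itvoo; rewrite ltrBlDr -addrA ltrDl addr_gt0.
      rewrite in_itv/= => /andP[q1 q2]; exists q.
      rewrite /ball/= ltr_norml ltrBDl ltrBlDl; move: q1 q2.
      by move: (k.+1%:R^-1) => r q1 q2; apply/andP; split; lra.
    pose q : 'rV[rat]_n := \row_j projT1 (cid (qP j)).
    have Fq j : ball (ctr q 0 j) k.+1%:R^-1 (F t 0 j).
      by rewrite !mxE; exact: (projT2 (cid (qP j))).
    exists (q, k) => //; rewrite /bx ifT; first by move=> j _; exact: Fq.
    apply/asboolP => y /= [_ qy]; apply: eU.
    split => // i j; rewrite (ord1 i).
    apply: (@ball_splitr _ _ (ctr q 0 j)).
      by apply: le_ball (Fq j); exact: ltW.
    by apply: le_ball (qy _ _); exact: ltW.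
  move=> [p _]; rewrite /bx; case: asboolP => // gp /= h.
  apply: gp; split; first by rewrite invr_gt0.
  by move=> i j; rewrite (ord1 i); exact: (h j).
apply: countable_bigcupT_measurable; first exact: countableP.
move=> p; rewrite /bx; case: asboolP => _ //.
apply: fin_bigcap_measurable => // j _.
rewrite -[X in measurable X]setTI; apply: mF => //.
exact: measurable_ball.
Qed.

Lemma continuous_borel_measurable (h : 'rV[R]_n -> R) :
  continuous h -> measurable_fun [set: borel_rV n] h.
Proof.
move=> /continuousP ch; apply: (measurability _ (RGenOpens.measurableE R)).
move=> _ [_ [a [b ->] <-]]; rewrite setTI.
by apply: sub_sigma_algebra; apply: ch; exact: interval_open.
Qed.

Lemma measurable_coord j :
  measurable_fun [set: borel_rV n] (fun x : 'rV[R]_n => x 0 j).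
Proof. by apply: continuous_borel_measurable; exact: coord_continuous. Qed.

Lemma measurable_rVP d (T : measurableType d) (F : T -> 'rV[R]_n) :
  measurable_fun [set: T] (F : T -> borel_rV n) <->
  forall j, measurable_fun [set: T] (fun t => F t 0 j).
Proof.
split => [mF j|]; last exact: measurable_rV.
exact: (measurableT_comp (measurable_coord j) mF).
Qed.

End Borel.

(** * Laws, independence and freezing *)

Section Law.
Context {R : realType} {dO dS : measure_display} {Om : measurableType dO}
  {S : measurableType dS} (P : probability Om R) (mu : probability S R).
Context (Z : Om -> S) (lawZ : has_law P Z mu).

Let mZ : measurable_fun [set: Om] Z := lawZ.1.

Lemma ge0_integral_law (h : S -> \bar R) : measurable_fun [set: S] h ->
  (forall s, 0 <= h s)%E -> (\int[P]_w h (Z w) = \int[mu]_s h s)%E.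
Proof.
move=> mh h0; have := @ge0_integral_pushforward _ _ _ _ R Z mZ P setT h.
rewrite preimage_setT => <- //.
by apply: eq_measure_integral => A mA _; exact: lawZ.2.
Qed.

Lemma ae_law (Q : set S) :
  {ae mu, forall s, Q s} -> {ae P, forall w, Q (Z w)}.
Proof.
move=> [N [mN N0 sub]]; exists (Z @^-1` N); split.
- by rewrite -[X in measurable X]setTI; exact: mZ.
- by rewrite lawZ.2.
- by move=> w /= nQ; exact: sub.
Qed.

Lemma L1_law (h : S -> R) : L1 mu h -> L1 P (fun w => h (Z w)).
Proof.
move=> Lh; have mh := L1_measurable Lh.
apply/integrableP; split; first by apply/measurable_EFinP;
  exact: measurableT_comp mh mZ.
rewrite (ge0_integral_law (h := fun s => `|(h s)%:E|%E))//.
  by have /integrableP[] := Lh.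
by do 2 apply: measurableT_comp => //.
Qed.

Lemma mean_law (h : S -> R) : L1 mu h -> mean P (fun w => h (Z w)) = mean mu h.
Proof.
move=> Lh; have mh : measurable_fun [set: S] (EFin \o h)
  by exact: measurable_int Lh.
rewrite /mean; congr fine.
have := @integral_pushforward _ _ _ _ R Z mZ P setT (EFin \o h).
rewrite preimage_setT => <- //; last exact: L1_law.
by apply: eq_measure_integral => A mA _; exact: lawZ.2.
Qed.

End Law.

Section JointLaw.
Context {R : realType} {dO d1 d2 : measure_display} {Om : measurableType dO}
  {S1 : measurableType d1} {S2 : measurableType d2} (P : probability Om R).

Lemma has_law_pair (mu1 : probability S1 R) (mu2 : probability S2 R)
    (Y : Om -> S1) (Z : Om -> S2) :
  has_law P Y mu1 -> has_law P Z mu2 -> indep2 P Y Z ->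
  has_law P (fun w => (Y w, Z w)) (mu1 \x mu2)%E.
Proof.
move=> lY lZ iYZ.
have mYZ : measurable_fun [set: Om] (fun w => (Y w, Z w)).
  by apply: measurable_fun_pair; [exact: lY.1|exact: lZ.1].
split => // A mA.
pose YZ : {mfun Om >-> (S1 * S2)%type} :=
  HB.pack (fun w => (Y w, Z w)) (isMeasurableFun.Build _ _ _ _ _ mYZ).
apply/esym/(product_measure_unique (m' := distribution P YZ)) => // B C mB mC.
transitivity (P (Y @^-1` B) * P (Z @^-1` C))%E; first exact: iYZ.
by congr (_ * _)%E; [exact: lY.2|exact: lZ.2].
Qed.

(** Integrating over one of two independent random variables first amounts to
    freezing the other one. *)
Lemma integral_freeze (Y : Om -> S1) (Z : Om -> S2) (h : S1 * S2 -> \bar R) :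
  measurable_fun [set: Om] Y -> measurable_fun [set: Om] Z -> indep2 P Y Z ->
  measurable_fun [set: S1 * S2] h -> (forall s, 0 <= h s)%E ->
  (\int[P]_w h (Y w, Z w) = \int[P]_w \int[P]_w' h (Y w, Z w'))%E.
Proof.
move=> mY mZ iYZ mh h0.
pose Y' : {mfun Om >-> S1} := HB.pack Y (isMeasurableFun.Build _ _ _ _ _ mY).
pose Z' : {mfun Om >-> S2} := HB.pack Z (isMeasurableFun.Build _ _ _ _ _ mZ).
have lY : has_law P Y (distribution P Y') by [].
have lZ : has_law P Z (distribution P Z') by [].
rewrite (ge0_integral_law (has_law_pair lY lZ iYZ) mh h0).
rewrite fubini_tonelli1//.
rewrite -(ge0_integral_law lY (h := fun s => \int[distribution P Z']_t h (s,
  t))%E).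
- apply: eq_integral => w _.
  rewrite (ge0_integral_law lZ (h := fun t => h (Y w, t)))//.
  exact: measurable_fun_pair2.
- have := @measurable_fun_fubini_tonelli_F _ _ _ _ R
    (distribution P Z') h mh h0.
  by rewrite /fubini_F.
- by move=> s; apply: integral_ge0.
Qed.

(** Replaces conditioning on [Y]: a bound for every frozen value of [Y] integrates
    to a bound in mean. *)
Lemma mean_freeze_le (Y : Om -> S1) (Z : Om -> S2) (h : S1 * S2 -> R)
    (u : Om -> R) :
  measurable_fun [set: Om] Y -> measurable_fun [set: Om] Z -> indep2 P Y Z ->
  measurable_fun [set: S1 * S2] h -> (forall s, 0 <= h s) -> L1 P u ->
  (forall w, \int[P]_w' (h (Y w, Z w'))%:E <= (u w)%:E)%E ->
  L1 P (fun w => h (Y w, Z w)) /\ mean P (fun w => h (Y w, Z w)) <= mean P u.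
Proof.
move=> mY mZ iYZ mh h0 Lu hu; apply: L1_of_le => //.
  by apply: measurableT_comp mh _; exact: measurable_fun_pair.
rewrite (integral_freeze (h := EFin \o h))//; last exact/measurable_EFinP.
rewrite -(mean_EFin Lu); apply: ge0_le_integral_nonmeasurable => // w.
by apply: integral_ge0 => w' _; rewrite lee_fin.
Qed.

Lemma mean_mul_indep (mu1 : probability S1 R) (mu2 : probability S2 R)
    (Y : Om -> S1) (Z : Om -> S2) (f : S1 -> R) (g : S2 -> R) :
  has_law P Y mu1 -> has_law P Z mu2 -> indep2 P Y Z ->
  L1 mu1 f -> L1 mu2 g ->
  L1 P (fun w => f (Y w) * g (Z w)) /\
  mean P (fun w => f (Y w) * g (Z w)) = mean mu1 f * mean mu2 g.
Proof.
move=> lY lZ iYZ Lf Lg; have mf := L1_measurable Lf;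
  have mg := L1_measurable Lg.
have lYZ := has_law_pair lY lZ iYZ.
pose h (s : S1 * S2) := f s.1 * g s.2.
have mh : measurable_fun setT h.
  by apply: measurable_funM; exact: measurableT_comp.
have Lh : L1 (mu1 \x mu2)%E h.
  have mEh : measurable_fun setT (EFin \o h) by exact/measurable_EFinP.
  apply/(integrable12ltyP mu1 mu2 mEh); rewrite /=.
  have E s : (\int[mu2]_t `|(h (s, t))%:E| = `|f s|%:E * \int[mu2]_t `|(g
    t)%:E|)%E.
    rewrite -ge0_integralZl//; first by apply: eq_integral => t _;
      rewrite /h/= normrM EFinM.
    by apply: measurableT_comp => //; exact/measurable_EFinP.
  under eq_integral do rewrite E.
  have /integrableP[_ fo] := Lf; have /integrableP[_ go] := Lg.
  rewrite ge0_integralZr//; last 2 first.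
    by do 2 apply: measurableT_comp => //.
    by apply: integral_ge0.
  rewrite lte_mul_pinfty//; first by apply: integral_ge0.
  by rewrite ge0_fin_numE//; apply: integral_ge0.
split; first exact: L1_law lYZ _ Lh.
rewrite (mean_law lYZ Lh) /mean -(integral12_prod_meas1 Lh) /fubini_F.
under eq_integral => s _.
  under eq_integral do rewrite /h/= EFinM.
  rewrite integralZl// (mean_EFin Lg) muleC; over.
by rewrite integralZl//= (mean_EFin Lf) mulrC.
Qed.

End JointLaw.

Section Past.
Context {R : realType} {dO dS : measure_display} {Om : measurableType dO}
  {S : measurableType dS} (P : probability Om R) (Z : nat -> Om -> S).
Hypothesis mZ : forall k, measurable_fun [set: Om] (Z k).
Hypothesis iZ : mutually_indep P Z.

(** Events decided by finitely many of the variables [Z 0, ..., Z n.-1], one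
    condition on each; they form a pi-system. *)
Definition cylinder n : set (set Om) :=
  [set E | exists A : nat -> set S, (forall k, measurable (A k)) /\
    E = \bigcap_(k in `I_n) (Z k @^-1` A k)].

Lemma prob_cylinder n (A : nat -> set S) : (forall k, measurable (A k)) ->
  P (\bigcap_(k in `I_n) (Z k @^-1` A k)) = (\prod_(k < n) P (Z k @^-1` A k))%E.
Proof.
move=> mA; have := @iZ (seq_fset tt (iota 0 n)) A (fun k _ => mA k).
have -> : [set` seq_fset tt (iota 0 n)] = `I_n.
  have E k : (k \in seq_fset tt (iota 0 n)) = (k < n)%N.
    by rewrite seq_fsetE mem_iota.
  by apply/seteqP; split => k /=; rewrite E.
move=> ->; rewrite (perm_big (iota 0 n)); last first.
  apply: uniq_perm; [exact: fset_uniq|exact: iota_uniq|].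
  by move=> k; rewrite seq_fsetE.
by rewrite -{1}(subn0 n) -/(index_iota 0 n) big_mkord.
Qed.

(** Both sides are finite measures in [E] that agree on cylinders, a pi-system. *)
Lemma cylinder_indep n E C : <<s cylinder n >> E -> measurable C ->
  (P (E `&` Z n @^-1` C) = P E * P (Z n @^-1` C))%E.
Proof.
move=> sE mC.
have mZC : measurable (Z n @^-1` C).
  by rewrite -[X in measurable X]setTI; exact: mZ.
have mcyl : cylinder n `<=` measurable.
  move=> _ [A [mA ->]]; apply: bigcap_measurableType => k _.
  by rewrite -[X in measurable X]setTI; exact: mZ.
have p0 : 0 <= fine (P (Z n @^-1` C)) by exact: fine_ge0.
have fp : P (Z n @^-1` C) \is a fin_num by exact: fin_num_measure.
rewrite [RHS]muleC -(fineK fp).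
apply: (@g_sigma_algebra_measure_unique _ R Om (cylinder n) mcyl (fun=> setT)
  _ _ (mrestr P mZC) (mscale (NngNum p0) P)) => //.
- move=> _; exists (fun=> setT); split => //.
  by apply/seteqP; split.
- by rewrite bigcup_const.
- move=> _ _ [A1 [mA1 ->]] [A2 [mA2 ->]]; exists (fun k => A1 k `&` A2 k);
  split.
    by move=> k; exact: measurableI.
  by rewrite -bigcapI.
- move=> _ [A [mA ->]].
  change (P ((\bigcap_(k in `I_n) (Z k @^-1` A k)) `&` Z n @^-1` C) =
    (fine (P (Z n @^-1` C)))%:E * P (\bigcap_(k in `I_n) (Z k @^-1` A k)))%E.
  rewrite fineK//.
  (* a cylinder intersected with the next event is a longer cylinder *)
  pose A' k := if k == n then C else A k.
  have mA' k : measurable (A' k) by rewrite /A'; case: ifP.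
  have := prob_cylinder n.+1 mA'.
  rewrite big_ord_recr/= /A' eqxx muleC => e.
  transitivity (P (\bigcap_(k in `I_n.+1) (Z k @^-1` A' k))).
    congr (P _); apply/seteqP; split => w /=.
      move=> [h1 h2] k /=; rewrite ltnS leq_eqVlt /A';
        case: eqP => [->//|_ /= kn].
      exact: h1.
    move=> h; split; last by have := h n (ltnSn n); rewrite /A' eqxx.
    move=> k /= kn; have := h k (ltnW kn); rewrite /A'.
    by case: eqP kn => // ->; rewrite ltnn.
  rewrite e prob_cylinder//; congr (_ * _)%E; apply: eq_bigr => k _.
  by rewrite ifN// ltn_eqF.
- by move=> k; rewrite [X in (X < _)%E](_ : _ = P ([set: Om] `&` Z n @^-1` C))//
  setTI (le_lt_trans (probability_le1 _ _))// ltry.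
Qed.

End Past.

(** * Second moments *)

Section SecondMoment.
Context {dO} {Om : measurableType dO} {R : realType} (P : probability Om R).
Context {n : nat}.

Lemma measurable_sqr_enorm d (T : measurableType d) (W : T -> 'rV[R]_n) :
  (forall j, measurable_fun [set: T] (fun t => W t 0 j)) ->
  measurable_fun [set: T] (fun t => enorm (W t) ^+ 2).
Proof.
move=> mW; under eq_fun do rewrite sqr_enorm_sum.
by apply: measurable_sum => j; exact: measurable_funX.
Qed.

(** Bias-variance identity around an arbitrary reference point [nu]: centring
    at the mean kills the cross terms with the deterministic [a]. *)
Lemma second_moment_shift (W : Om -> 'rV[R]_n) (mu nu a : 'rV[R]_n) :
  (forall j, L1 P (fun w => W w 0 j) /\ mean P (fun w => W w 0 j) = mu 0 j) ->
  L1 P (fun w => enorm (W w - nu) ^+ 2) ->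
  L1 P (fun w => enorm (a + (W w - mu)) ^+ 2) /\
  mean P (fun w => enorm (a + (W w - mu)) ^+ 2) =
    enorm a ^+ 2 + mean P (fun w => enorm (W w - nu) ^+ 2) - enorm (mu - nu) ^+
      2.
Proof.
move=> hW L2.
(* the sum of the cross terms is [2 <q, W - mu>], of mean 0 *)
pose q := a - (mu - nu).
have Lu j : L1 P (fun w => W w 0 j - mu 0 j).
  by apply: L1B; [exact: (hW j).1|exact: L1_cst].
have Lq : L1 P (fun w => \sum_(j < n) q 0 j * (W w 0 j - mu 0 j)).
  by apply: L1_sum => j; exact: L1Z.
have Mq : mean P (fun w => \sum_(j < n) q 0 j * (W w 0 j - mu 0 j)) = 0.
  rewrite mean_sum => [|j]; last exact: L1Z.
  apply: big1 => j _; rewrite meanZ// meanB ?mean_cst;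
    [|exact: (hW j).1|exact: L1_cst].
  by rewrite (hW j).2 subrr mulr0.
have E w : enorm (a + (W w - mu)) ^+ 2 = enorm (W w - nu) ^+ 2 +
    2 * (\sum_(j < n) q 0 j * (W w 0 j - mu 0 j)) +
    (enorm a ^+ 2 - enorm (mu - nu) ^+ 2).
  have -> : \sum_(j < n) q 0 j * (W w 0 j - mu 0 j) = dotv q (W w - mu).
    by apply: eq_bigr => j _; rewrite !mxE.
  have -> : W w - nu = (mu - nu) + (W w - mu) by rewrite [RHS]addrC addrA subrK.
  rewrite !sqr_enormD /q (dotvBl a (mu - nu)); ring.
under eq_fun do rewrite E.
have L1' := L1D L2 (L1Z 2 Lq).
split; first by apply: L1D => //; exact: L1_cst.
rewrite meanD//; last exact: L1_cst.
rewrite meanD//; last exact: L1Z.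
by rewrite meanZ// Mq mean_cst mulr0 addr0; ring.
Qed.

(** Jensen's inequality, as the nonnegativity of the variance. *)
Lemma sqr_enorm_mean_le (W : Om -> 'rV[R]_n) (mu : 'rV[R]_n) :
  (forall j, L1 P (fun w => W w 0 j) /\ mean P (fun w => W w 0 j) = mu 0 j) ->
  L1 P (fun w => enorm (W w) ^+ 2) ->
  enorm mu ^+ 2 <= mean P (fun w => enorm (W w) ^+ 2).
Proof.
move=> hW L2.
have L2' : L1 P (fun w => enorm (W w - 0) ^+ 2).
  by under eq_fun do rewrite subr0.
have [_] := second_moment_shift 0 hW L2'.
rewrite subr0 enorm0 expr0n/= add0r; under [in RHS]eq_fun do rewrite subr0.
move=> E; rewrite -subr_ge0 -E; apply: mean_ge0 => w; exact: sqr_ge0.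
Qed.

End SecondMoment.

(** * Uniform random index *)

Section UniformIndex.
Context {R : realType} {dO : measure_display} {Om : measurableType dO}
  (P : probability Om R).

Lemma measurable_prod_nat d (T : measurableType d) (F : Om * nat -> T) :
  (forall k, measurable_fun [set: Om] (fun w => F (w, k))) ->
  measurable_fun [set: Om * nat] F.
Proof.
move=> mF _ A mA; rewrite setTI.
have -> : F @^-1` A = \bigcup_k (((fun w => F (w, k)) @^-1` A) `*` [set k]).
  apply/seteqP; split => [[w k] /= Fwk|[w k] [j _ [/= Fwk ->]]//].
  by exists k.
apply: bigcupT_measurable => k; apply: measurableX => //.
by rewrite -[X in measurable X]setTI; exact: mF.
Qed.

Lemma integral_unif1 K (h : nat -> \bar R) : (0 < K)%N ->
  (forall k, 0 <= h k)%E ->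
  (\int[unif1 K]_k h k = (K%:R^-1)%:E * \sum_(k < K) h k.+1)%E.
Proof.
move=> K0 h0.
have mh : measurable_fun [set: nat] h by [].
have Kp : 0 <= (K%:R : R)^-1 by rewrite invr_ge0.
pose mu : {measure set nat -> \bar R} := msum (fun k => @dirac _ nat k.+1 R) K.
have muT : mu setT = K%:R%:E.
  rewrite /mu /= /msum (eq_bigr (fun=> 1%:E)) => [|k _];
    last by rewrite /= diracT.
  by rewrite sumEFin sumr_const card_ord.
rewrite (@eq_measure_integral _ _ _ setT (mscale (NngNum Kp) mu)) => [|A mA _];
  last first.
  have norm : mnormalize mu \d_1%N A = (mu A * (K%:R^-1)%:E)%E.
    rewrite /mnormalize muT ifN// negb_or andbT.
    by rewrite eqe pnatr_eq0 -lt0n.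
  exact: etrans norm (muleC _ _).
rewrite ge0_integral_mscale// /mu ge0_integral_measure_sum//.
congr (_ * _)%E; apply: eq_bigr => k _.
by rewrite integral_dirac//= diracT mul1e.
Qed.

(** The integrand may fail to be measurable, since it involves distances to moving
    normal cones; its value at the index 0, which has probability 0, is
    covered by the majorant [+oo]. *)
Lemma expectation_unif1_le K (h : Om * nat -> R) (u : nat -> Om -> R) :
  (0 < K)%N -> (forall z, 0 <= h z) ->
  (forall k, (1 <= k)%N -> L1 P (u k)) ->
  (forall k w, (1 <= k)%N -> h (w, k) <= u k w) ->
  ('E_(P \x unif1 K)[h] <= (K%:R^-1 * \sum_(k < K) mean P (u k.+1))%:E)%E.
Proof.
move=> K0 h0 Lu hu; rewrite expectation.unlock.
pose H (z : Om * nat) : \bar R := if z.2 == 0 then +oo%E else (u z.2 z.1)%:E.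
have mH : measurable_fun [set: Om * nat] H.
  apply: measurable_prod_nat => -[|k]; first exact: measurable_cst.
  by apply/measurable_EFinP; exact: L1_measurable (Lu k.+1 isT).
have hH z : ((h z)%:E <= H z)%E.
  by case: z => w [|k]; rewrite /H/= ?leey// lee_fin; exact: hu.
have H0 z : (0 <= H z)%E by apply: le_trans (hH z); rewrite lee_fin.
apply: (@le_trans _ _ (\int[P \x unif1 K]_z H z)%E).
  apply: ge0_le_integral_nonmeasurable => z //; by rewrite lee_fin.
rewrite fubini_tonelli2// integral_unif1//; last first.
  by move=> k; apply: integral_ge0.
rewrite EFinM -sumEFin; rewrite le_eqVlt; apply/orP; left; apply/eqP;
  congr (_ * _)%E; apply: eq_bigr => k _.
by rewrite /fubini_G /H/= mean_EFin//; exact: Lu.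
Qed.

End UniformIndex.

(** * The step-size schedule *)

Section Schedule.
Context {R : realType}.

Definition root5 (k : nat) : R := k%:R `^ (1 / 5).

Lemma root5_ge0 k : 0 <= root5 k.
Proof. exact: powR_ge0. Qed.

Lemma root5X k n : root5 k ^+ n = k%:R `^ (n%:R / 5).
Proof. by rewrite /root5 -powR_mulrn ?powR_ge0// -powRrM mulrAC mul1r mulrC.
  Qed.

Lemma root5K k : root5 k ^+ 5 = k%:R.
Proof. by rewrite root5X divff// powRr1. Qed.

Lemma root5_ge1 k : (0 < k)%N -> 1 <= root5 k.
Proof.
move=> k0; rewrite -(@ler_pXn2r _ 5)// ?nnegrE ?root5_ge0// expr1n root5K.
by rewrite ler1n.
Qed.

Lemma step_rhoE (rho : R) k : step_rho rho k = rho * root5 k.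
Proof. by []. Qed.

Lemma step_etaE (L rho : R) k :
  step_eta L rho k = (9 * L * rho * root5 k.+1 ^+ 3)^-1.
Proof. by rewrite /step_eta root5X div1r. Qed.

Lemma step_alphaE k : step_alpha k = 8 / (9 * root5 k ^+ 4) :> R.
Proof.
rewrite /step_alpha root5X; set t := _ `^ _; rewrite (_ : 81 = 9 * 9 :> R);
  last by lra.
by rewrite (_ : 72 = 9 * 8 :> R) ?mulf_div; [rewrite -mulrA -mulf_div divff
  ?mul1r|lra].
Qed.

(** In terms of [u = k^(1/5)] and [v = (k+1)^(1/5)] all the schedules are
    rational functions, and [v - u <= 1/(5 u^4)] because [v^5 - u^5 = 1]. *)
Context (u v : R).

Lemma root5_gt0 (t : R) : 1 <= t -> 0 < t.
Proof. exact: lt_le_trans. Qed.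

Lemma root5_succ_le : 1 <= u -> 1 <= v -> v ^+ 5 = u ^+ 5 + 1 ->
  u <= v.
Proof.
move=> u1 v1 uv.
have u0 := ltW (root5_gt0 u1).
have v0 := ltW (root5_gt0 v1).
by rewrite -(@ler_pXn2r _ 5)// ?nnegrE// uv lerDl.
Qed.

Lemma root5_succ_sub : 1 <= u -> 1 <= v -> v ^+ 5 = u ^+ 5 + 1 ->
  v - u <= 1 / (5 * u ^+ 4).
Proof.
move=> u1 v1 uv.
have uv' := (root5_succ_le u1 v1 uv); have u0 := ltW (root5_gt0 u1).
  have v0 := ltW (root5_gt0 v1).
have p4 : 0 < 5 * u ^+ 4 by rewrite mulr_gt0 ?exprn_gt0// root5_gt0.
rewrite ler_pdivlMr//.
have E : v ^+ 5 - u ^+ 5 = 1 by rewrite uv addrC addKr.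
rewrite -[leRHS]E (_ : _ - u ^+ 5 = (v - u) *
  (v ^+ 4 + v ^+ 3 * u + v ^+ 2 * u ^+ 2 + v * u ^+ 3 + u ^+ 4)); last by ring.
rewrite ler_wpM2l ?subr_ge0//.
have h4 : u ^+ 4 <= v ^+ 4 by rewrite lerXn2r ?nnegrE.
have h3 : u ^+ 4 <= v ^+ 3 * u.
  by rewrite exprSr ler_wpM2r// lerXn2r ?nnegrE.
have h2 : u ^+ 4 <= v ^+ 2 * u ^+ 2.
  by rewrite -[4%N]/(2 + 2)%N exprD ler_wpM2r ?sqr_ge0// lerXn2r ?nnegrE.
have h1 : u ^+ 4 <= v * u ^+ 3 by rewrite exprS ler_wpM2r ?exprn_ge0.
lra.
Qed.

Lemma root5_succ_ratio : 1 <= u -> 1 <= v -> v ^+ 5 = u ^+ 5 + 1 ->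
  v <= 6 / 5 * u.
Proof.
move=> u1 v1 uv.
have h := (root5_succ_sub u1 v1 uv).
suff : 1 / (5 * u ^+ 4) <= 1 / 5 * u.
  by move: (1 / (5 * u ^+ 4)) h => t ? ?; lra.
rewrite ler_pdivrMr; last by rewrite mulr_gt0 ?exprn_gt0//; lra.
have : 1 <= u ^+ 5 by exact: exprn_ege1.
by rewrite exprS; move: (u ^+ 4) => t; lra.
Qed.

Context (L rho : R).

Let eta := (9 * L * rho * v ^+ 3)^-1.
Let al := 8 / (9 * v ^+ 4).
Let theta t := t / (2 * L * rho).

(** The contraction gains [theta v * al], of order [v^-3] like [eta], while the
    drift [v - u] of the weight is only of order [u^-4]. *)
Lemma weight_contraction : 0 < L -> 1 < rho ->
  1 <= u -> 1 <= v -> v ^+ 5 = u ^+ 5 + 1 ->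
  theta v * (1 - al) ^+ 2 <= theta u - eta.
Proof.
move=> L0 rho1 u1 v1 uv.
have v0 := root5_gt0 v1. have rho0 := root5_gt0 (ltW rho1).
have h1 := (root5_succ_sub u1 v1 uv); have h2 := (root5_succ_ratio u1 v1 uv).
pose t := v^-1; have t0 : 0 < t by rewrite invr_gt0.
have t1 : t <= 1 by rewrite invf_le1.
have vt : v * t = 1 by rewrite divff ?gt_eqF.
have -> : eta = (2 / 9 * t ^+ 3) / (2 * L * rho).
  rewrite /eta /t; field; do ?[apply/andP; split]; by rewrite gt_eqF.
have -> : al = 8 / 9 * t ^+ 4 by rewrite /al /t; field; rewrite gt_eqF.
rewrite /theta mulrAC -mulrBl ler_pM2r ?invr_gt0 ?mulr_gt0//.
have -> : v * (1 - 8 / 9 * t ^+ 4) ^+ 2 =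
    v - 16 / 9 * t ^+ 3 + 64 / 81 * (t ^+ 4 * t ^+ 3).
  transitivity (v - 16 / 9 * (v * t) * t ^+ 3 +
     64 / 81 * (v * t) * (t ^+ 4 * t ^+ 3)); first by field.
  by rewrite vt !mulr1.
have t3 : 0 < t ^+ 3 by rewrite exprn_gt0.
have h7 : t ^+ 4 * t ^+ 3 <= t ^+ 3.
  by rewrite ler_piMl ?(ltW t3)// exprn_ile1// ltW.
have h3 : 1 / (5 * u ^+ 4) <= 2 / 5 * t ^+ 3.
  have p4 : 0 < 5 * u ^+ 4 by rewrite mulr_gt0 ?exprn_gt0// root5_gt0.
  rewrite ler_pdivrMr//.
  have ut : 5 / 6 <= u * t by rewrite /t ler_pdivlMr//; lra.
  have h : (5 / 6) ^+ 3 <= (u * t) ^+ 3.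
    by rewrite lerXn2r ?nnegrE// (le_trans _ ut).
  have k : u ^+ 3 * t ^+ 3 <= u ^+ 4 * t ^+ 3.
    by rewrite ler_wpM2r ?(ltW t3)// ler_weXn2l.
  have E : 2 / 5 * t ^+ 3 * (5 * u ^+ 4) = 2 * (u ^+ 4 * t ^+ 3) by field.
  move: h k; rewrite E (exprMn _ u t) (_ : (5 / 6) ^+ 3 = 125 / 216 :> R);
    last by field.
  by move: (u ^+ 4 * t ^+ 3) (u ^+ 3 * t ^+ 3) => ? ? ? ?; lra.
move: h1 h3 h7; move: (1 / (5 * u ^+ 4)) (t ^+ 4 * t ^+ 3) => ? ? ? ? ?; lra.
Qed.

(** The cost of a step in the momentum recursion is a fixed fraction of what the
    descent inequality pays for it. *)
Lemma weight_step : 0 < L -> 1 < rho ->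
  1 <= u -> 1 <= v -> v ^+ 5 = u ^+ 5 + 1 ->
  theta v * (4 * L ^+ 2 * (rho * u) ^+ 2) <= 2 / 9 / eta.
Proof.
move=> L0 rho1 u1 v1 uv.
have v0 := root5_gt0 v1. have rho0 := root5_gt0 (ltW rho1).
have -> : theta v * (4 * L ^+ 2 * (rho * u) ^+ 2) = 2 * L * rho * (v * u ^+ 2).
  by rewrite /theta; field; apply/andP; split; rewrite gt_eqF.
have -> : 2 / 9 / eta = 2 * L * rho * (v * v ^+ 2).
  by rewrite /eta invrK; field.
apply: ler_wpM2l; first by rewrite !mulr_ge0// ltW.
apply: ler_wpM2l; first exact: ltW.
rewrite ler_sqr ?nnegrE ?(ltW v0) ?(ltW (root5_gt0 u1))//.
exact: root5_succ_le.
Qed.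

Lemma smoothness_step : 0 < L -> 1 < rho ->
  1 <= u -> 1 <= v -> v ^+ 5 = u ^+ 5 + 1 ->
  L * (rho * u) <= 1 / 9 / eta.
Proof.
move=> L0 rho1 u1 v1 uv.
rewrite /eta invrK (_ : 1 / 9 * _ = L * rho * v ^+ 3); last by field.
have rho0 := root5_gt0 (ltW rho1).
rewrite mulrA; apply: ler_wpM2l; first by rewrite mulr_ge0 ?ltW.
apply: (le_trans (root5_succ_le u1 v1 uv)); rewrite -{1}(expr1 v).
by rewrite ler_weXn2l.
Qed.

(** The variance of the fresh gradient grows like [u^2] and is damped by
    [al^2 = O(v^-8)]; with the weight [theta = O(v)] this leaves [v^-5 = 1/(k+1)]. *)
Lemma weight_noise (a w M : R) : 0 < L -> 1 < rho ->
  1 <= u -> 1 <= v -> v ^+ 5 = u ^+ 5 + 1 ->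
  0 <= a -> 0 <= w ->
  theta v * (2 * al ^+ 2 * (2 * a + 4 * (rho * v) ^+ 2 * w) +
             4 * (rho * v - rho * u) ^+ 2 * M ^+ 2)
  <= ((2 * a + 4 * rho ^+ 2 * w) / (L * rho) + rho * M ^+ 2 / L) / u ^+ 5.
Proof.
move=> L0 rho1 u1 v1 uv a0 w0.
have v0 := root5_gt0 v1. have rho0 := root5_gt0 (ltW rho1).
  have u0 := root5_gt0 u1.
have h0 := (root5_succ_le u1 v1 uv); have h1 := (root5_succ_sub u1 v1 uv);
  have h2 := (root5_succ_ratio u1 v1 uv).
rewrite mulrDr [leRHS]mulrDl; apply: lerD.
  have -> : theta v * (2 * al ^+ 2 * (2 * a + 4 * (rho * v) ^+ 2 * w)) =
      64 / 81 * ((2 * a / v ^+ 2 + 4 * rho ^+ 2 * w) / (L * rho) / v ^+ 5).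
    rewrite /theta /al; field.
    do ?[apply/andP; split]; by rewrite gt_eqF.
  have Lr : 0 < L * rho by rewrite mulr_gt0.
  have a20 : 0 <= 2 * a by rewrite mulr_ge0.
  have w40 : 0 <= 4 * rho ^+ 2 * w by rewrite mulr_ge0// mulr_ge0// sqr_ge0.
  have p5 : 0 < (v ^+ 5)^-1 by rewrite invr_gt0 exprn_gt0.
  have X0 : 0 <= (2 * a + 4 * rho ^+ 2 * w) / (L * rho).
    by rewrite divr_ge0 ?addr_ge0// ltW.
  apply: (@le_trans _ _ ((2 * a + 4 * rho ^+ 2 * w) / (L * rho) / v ^+ 5)).
    apply: (@le_trans _ _ (64 / 81 *
      ((2 * a + 4 * rho ^+ 2 * w) / (L * rho) / v ^+ 5))).
      rewrite ler_wpM2l// ler_wpM2r ?(ltW p5)//.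
      rewrite ler_wpM2r ?invr_ge0 ?(ltW Lr)// lerD2r.
      by rewrite ler_piMr// invf_le1 ?exprn_gt0// exprn_ege1.
    have : 0 <= (2 * a + 4 * rho ^+ 2 * w) / (L * rho) / v ^+ 5.
      by rewrite mulr_ge0// ltW.
    by move: ((2 * a + 4 * rho ^+ 2 * w) / (L * rho) / v ^+ 5) => t; lra.
  rewrite ler_wpM2l// lef_pV2 ?posrE ?exprn_gt0//.
  by rewrite ler_pXn2r ?nnegrE ?(ltW u0) ?(ltW v0).
rewrite -mulrBr exprMn.
have d0 : 0 <= v - u by lra.
have d2 : (v - u) ^+ 2 <= 1 / (25 * u ^+ 8).
  have -> : 1 / (25 * u ^+ 8) = (1 / (5 * u ^+ 4)) ^+ 2.
    by field; rewrite gt_eqF.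
  by rewrite ler_sqr ?nnegrE// divr_ge0// mulr_ge0// exprn_ge0// ltW.
have -> : theta v * (4 * (rho ^+ 2 * (v - u) ^+ 2) * M ^+ 2) =
    (2 * rho * M ^+ 2 / L) * (v * (v - u) ^+ 2).
  by rewrite /theta; field; apply/andP; split; rewrite gt_eqF.
have -> : rho * M ^+ 2 / L / u ^+ 5 = (2 * rho * M ^+ 2 / L) * (1 / 2 / u ^+ 5).
  by field; apply/andP; split; rewrite gt_eqF.
have Q0 : 0 <= 2 * rho * M ^+ 2 / L.
  by rewrite divr_ge0 ?(ltW L0)// mulr_ge0 ?sqr_ge0// mulr_ge0// ltW.
rewrite ler_wpM2l//.
apply: (@le_trans _ _ (6 / 5 * u * (1 / (25 * u ^+ 8)))).
  by rewrite ler_pM ?sqr_ge0 ?(ltW v0).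
have -> : 6 / 5 * u * (1 / (25 * u ^+ 8)) = 6 / 125 / u ^+ 5 / u ^+ 2.
  by field; rewrite gt_eqF.
have p5 : 0 < (u ^+ 5)^-1 by rewrite invr_gt0 exprn_gt0.
have p2 : (u ^+ 2)^-1 <= 1 by rewrite invf_le1 ?exprn_gt0// exprn_ege1.
apply: (@le_trans _ _ (6 / 125 / u ^+ 5)).
  by rewrite ler_piMr// mulr_ge0// ltW.
by rewrite ler_wpM2r ?(ltW p5)//; lra.
Qed.

(** The penalty parameter grows relatively by [O(1/k)]; the feasibility measure
    [z] it multiplies is controlled by a residual [r], whose square is absorbed
    by Young's inequality at the price of another [O(1/k)]. *)
Lemma penalty_growth (Cc G delta z r : R) : 0 < L -> 1 < rho ->
  1 <= u -> 1 <= v -> v ^+ 5 = u ^+ 5 + 1 ->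
  0 < delta -> 0 <= z -> z <= Cc -> 0 <= G -> 0 <= r ->
  delta * (rho * u) * z <= G + r ->
  (rho * v - rho * u) / 2 * z ^+ 2 <= eta * r ^+ 2 / 64 +
    (Cc * G / delta + 3 * Cc ^+ 2 * L * rho / delta ^+ 2) / u ^+ 5.
Proof.
move=> L0 rho1 u1 v1 uv dl0 z0 zC G0 r0 hz.
have v0 := root5_gt0 v1. have rho0 := root5_gt0 (ltW rho1).
  have u0 := root5_gt0 u1.
have h0 := (root5_succ_le u1 v1 uv); have h1 := (root5_succ_sub u1 v1 uv).
have C0 : 0 <= Cc by lra.
have eta0 : 0 < eta by rewrite invr_gt0 !mulr_gt0 ?exprn_gt0.
have p5 : 0 < (u ^+ 5)^-1 by rewrite invr_gt0 exprn_gt0.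
have d10 : 0 < (10 * delta * u ^+ 5)^-1 by rewrite invr_gt0 !mulr_gt0
  ?exprn_gt0.
pose b := Cc / (10 * delta * u ^+ 5).
have b0 : 0 <= b by rewrite mulr_ge0// ltW.
have step1 : (rho * v - rho * u) / 2 * z ^+ 2 <= b * (G + r).
  have zle : z <= (G + r) / (delta * (rho * u)).
    by rewrite ler_pdivlMr ?mulr_gt0// mulrC.
  have zz : z ^+ 2 <= Cc * ((G + r) / (delta * (rho * u))).
    by rewrite expr2 ler_pM.
  have -> : b * (G + r) = rho * (1 / (5 * u ^+ 4)) / 2 *
      (Cc * ((G + r) / (delta * (rho * u)))).
    by rewrite /b; field; do ?[apply/andP; split]; rewrite gt_eqF.
  rewrite ler_pM ?sqr_ge0//.
    by rewrite -mulrBr divr_ge0// mulr_ge0 ?subr_ge0// ltW.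
  by rewrite -mulrBr ler_wpM2r// ler_wpM2l// ltW.
apply: (le_trans step1).
have young : b * r <= eta * r ^+ 2 / 64 + 16 * b ^+ 2 / eta.
  rewrite -subr_ge0.
  have -> : eta * r ^+ 2 / 64 + 16 * b ^+ 2 / eta - b * r =
     eta * (r / 8 - 4 * b / eta) ^+ 2 by field; rewrite gt_eqF.
  by rewrite mulr_ge0 ?sqr_ge0// ltW.
have bG : b * G <= Cc * G / delta / u ^+ 5.
  have -> : b * G = 1 / 10 * (Cc * G / delta / u ^+ 5).
    by rewrite /b; field; do ?[apply/andP; split]; rewrite gt_eqF.
  have : 0 <= Cc * G / delta / u ^+ 5.
    by rewrite mulr_ge0 ?(ltW p5)// divr_ge0 ?(ltW dl0)// mulr_ge0.
  by move: (Cc * G / delta / u ^+ 5) => t; lra.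
have bb : 16 * b ^+ 2 / eta <= 3 * Cc ^+ 2 * L * rho / delta ^+ 2 / u ^+ 5.
  have v3 : v ^+ 3 <= 2 * u ^+ 5.
    have u5 : 1 <= u ^+ 5 by exact: exprn_ege1.
    have : v ^+ 3 <= v ^+ 5 by rewrite ler_weXn2l.
    by rewrite uv; move: (u ^+ 5) u5 (v ^+ 3) => p p1 q; lra.
  have -> : 16 * b ^+ 2 / eta = 36 / 25 * (Cc ^+ 2 * L * rho / delta ^+ 2) *
      (u ^+ 5)^-1 * ((u ^+ 5)^-1 * v ^+ 3).
    by rewrite /b /eta; field; do ?[apply/andP; split]; rewrite gt_eqF.
  have -> : 3 * Cc ^+ 2 * L * rho / delta ^+ 2 / u ^+ 5 =
     36 / 25 * (Cc ^+ 2 * L * rho / delta ^+ 2) * (u ^+ 5)^-1 * (25 / 12).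
    by field; do ?[apply/andP; split]; rewrite gt_eqF.
  rewrite ler_wpM2l//.
    rewrite mulr_ge0 ?(ltW p5)// mulr_ge0// divr_ge0 ?sqr_ge0//.
    by rewrite mulr_ge0 ?(ltW rho0)// mulr_ge0 ?(ltW L0)// sqr_ge0.
  rewrite mulrC ler_pdivrMr ?exprn_gt0//.
  have : 0 < u ^+ 5 by rewrite exprn_gt0.
  by move: (u ^+ 5) (v ^+ 3) v3 => p q; lra.
rewrite mulrDr [X in _ <= _ + X]mulrDl.
move: (b * G) (b * r) (eta * r ^+ 2 / 64) (16 * b ^+ 2 / eta) young bG bb.
by move=> ? ? ? ?; lra.
Qed.

End Schedule.

Section Budget.
Context {R : realType}.
Implicit Types (L rho : R).
Local Notation root5 := (@root5 R).

Lemma root5_le j k : (j <= k)%N -> root5 j <= root5 k :> R.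
Proof.
by move=> jk; rewrite -(@ler_pXn2r _ 5)// ?nnegrE ?root5_ge0// !root5K ler_nat.
Qed.

Lemma step_eta_inv_le L rho k : 0 < L -> 0 < rho -> (0 < k)%N ->
  (step_eta L rho k)^-1 <= 16 * L * rho * root5 k ^+ 3.
Proof.
move=> L0 rho0 k0; rewrite step_etaE invrK.
have u1 := @root5_ge1 R _ k0; have v1 := @root5_ge1 R _ (ltn0Sn k).
have uv : root5 k.+1 ^+ 5 = root5 k ^+ 5 + 1 :> R by rewrite !root5K -natr1.
have r := root5_succ_ratio u1 v1 uv.
have h : root5 k.+1 ^+ 3 <= 216 / 125 * root5 k ^+ 3.
  have -> : 216 / 125 * root5 k ^+ 3 = (6 / 5 * root5 k) ^+ 3 by field.
  by rewrite ler_pXn2r ?nnegrE ?mulr_ge0 ?root5_ge0.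
have Lr : 0 <= L * rho by rewrite mulr_ge0 ?ltW.
have := ler_wpM2l Lr h; have := exprn_ge0 3 (@root5_ge0 R k).
move: (root5 k.+1 ^+ 3) (root5 k ^+ 3) => p q q0;
  rewrite -!(mulrA _ L) -!(mulrA _ (L * rho)).
have := mulr_ge0 Lr q0; rewrite (mulrCA (L * rho)).
by move: (L * rho * p) (L * rho * q) => *; lra.
Qed.

Lemma step_eta_mono L rho j k : 0 < L -> 0 < rho -> (j <= k)%N ->
  step_eta L rho k <= step_eta L rho j.
Proof.
move=> L0 rho0 jk; rewrite !step_etaE.
have p i : 0 < root5 i.+1 by rewrite (lt_le_trans ltr01)// root5_ge1.
have Lr : 0 < 9 * L * rho by rewrite mulr_gt0// mulr_gt0.
rewrite lef_pV2 ?posrE ?(mulr_gt0 Lr) ?exprn_gt0//.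
by rewrite ler_pM2l// ler_pXn2r ?nnegrE ?(ltW (p _))// root5_le.
Qed.

Definition harmonic_sum K : R := \sum_(k < K) k.+1%:R^-1.

Lemma harmonic_sum_ge0 K : 0 <= harmonic_sum K.
Proof. by apply: sumr_ge0 => k _; rewrite invr_ge0. Qed.

Lemma harmonic_sum_le K : (0 < K)%N -> harmonic_sum K <= 1 + ln K%:R.
Proof.
case: K => // K _; elim: K => [|K ih].
  by rewrite /harmonic_sum big_ord_recl big_ord0 ln1 invr1.
rewrite /harmonic_sum big_ord_recr/= -/(harmonic_sum K.+1).
have K1 : 0 < K.+1%:R :> R by rewrite ltr0n.
have K2 : 0 < K.+2%:R :> R by rewrite ltr0n.
have : ln (K.+1%:R / K.+2%:R) <= - K.+2%:R^-1 :> R.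
  have -> : K.+1%:R / K.+2%:R = 1 + (- K.+2%:R^-1) :> R.
    have E : K.+2%:R = K.+1%:R + 1 :> R by rewrite natr1.
    by rewrite E in K2 *; field; rewrite gt_eqF.
  apply: le_ln1Dx; rewrite ltrN2 invf_lt1// ltr1n//.
rewrite ln_div ?posrE//; move: ih.
by move: (K.+2%:R^-1) (ln K.+1%:R) (ln K.+2%:R) => a b e; lra.
Qed.

Lemma sum_inv_root5_le K : (0 < K)%N ->
  \sum_(k < K) (root5 k.+1)^-1 <= K%:R * ((1 + harmonic_sum K) / root5 K).
Proof.
move=> K0; have U0 : 0 < root5 K by rewrite (lt_le_trans ltr01)// root5_ge1.
apply: (@le_trans _ _ (\sum_(k < K) (root5 K)^-1 * (1 + K%:R * k.+1%:R^-1))).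
  apply: ler_sum => k _.
  have u0 : 0 < root5 k.+1 by rewrite (lt_le_trans ltr01)// root5_ge1.
  rewrite -ler_pdivrMl ?invr_gt0// invrK -(root5K K) -(root5K k.+1) -exprVn
    -exprMn.
  have t0 : 0 < root5 K * (root5 k.+1)^-1 by rewrite mulr_gt0 ?invr_gt0.
  (* it remains to see that [t <= 1 + t^5] for [t = root5 K / root5 k.+1] *)
  move: (root5 K * _) t0 => t t0; have [t1|/ltW t1] := leP t 1.
    by rewrite (le_trans t1)// lerDl exprn_ge0// ltW.
  rewrite (@le_trans _ _ (t ^+ 5))//; last by rewrite lerDr.
  by rewrite -{1}(expr1 t) ler_weXn2l.
rewrite -mulr_sumr big_split/= sumr_const card_ord -mulr_sumr -/(harmonic_sum
  K).
rewrite le_eqVlt; apply/orP; left; apply/eqP; ring.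
Qed.

(** With [l = ln (1 / e)] and [K] about [(2 M l / e)^5] the fifth root of [K] is at
    least [2 M l / e], while [ln K] grows only linearly in [l] and, as
    [ln M = 2 ln N <= 2 N], linearly in [N = sqrt M]. So [M] can absorb [A]. *)
Lemma choose_budget (A : R) : 0 < A -> exists2 C : R, 0 < C &
  forall e, 0 < e -> e <= 1 / 2 -> exists K : nat, [/\ (0 < K)%N,
    K%:R <= C * e ^- 5 * ln (1 / e) `^ 5 &
    A * (2 + ln K%:R) / root5 K <= e].
Proof.
move=> A0; pose N := 46 * A + 1.
have N1 : 1 <= N by rewrite /N; lra.
have N0 : 0 < N by lra.
pose M := N ^+ 2.
have M1 : 1 <= M by rewrite exprn_ege1.
have M0 : 0 < M by lra.
exists (2 * (2 * M) ^+ 5); first by rewrite mulr_gt0// exprn_gt0// mulr_gt0.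
move=> e e0 e2.
pose l := ln (1 / e).
have hl : l = - ln e by rewrite /l div1r lnV ?posrE.
have l2 : 1 / 2 <= l.
  have : ln (1 - 1 / 2) <= - (1 / 2) :> R by apply: le_ln1Dx; lra.
  have : ln e <= ln (1 - 1 / 2) :> R by rewrite ler_ln ?posrE//; lra.
  by rewrite hl; move: (ln e) (ln (1 - 1 / 2)) => *; lra.
have l0 : 0 < l by lra.
pose y := (M * (2 * l) / e) ^+ 5.
have Ml0 : 0 < M * (2 * l) / e by rewrite divr_gt0// mulr_gt0// mulr_gt0.
have Ml1 : 1 <= M * (2 * l) / e.
  rewrite ler_pdivlMr// mul1r (le_trans e2)// (@le_trans _ _ (M * 1))//;
    first by lra.
  by rewrite ler_pM2l//; lra.
have y1 : 1 <= y by exact: exprn_ege1.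
pose K := (Num.truncn y).+1.
have yK : y <= K%:R by rewrite ltW// truncnS_gt.
have Ky : K%:R <= 2 * y.
  have : (Num.truncn y)%:R <= y by rewrite truncn_le//; lra.
  by rewrite /K -natr1; lra.
exists K; split => //.
- rewrite (le_trans Ky)// le_eqVlt; apply/orP; left; apply/eqP.
  by rewrite powR_mulrn ?(ltW l0)// -/l /y; field; rewrite gt_eqF.
have U0 : 0 < root5 K by rewrite (lt_le_trans ltr01)// root5_ge1.
have Uy : M * (2 * l) / e <= root5 K.
  by rewrite -(@ler_pXn2r _ 5)// ?nnegrE ?(ltW U0) ?(ltW Ml0)// root5K.
have lnK : ln K%:R <= 1 + 10 * N + 20 * l.
  have K0 : 0 < K%:R :> R by rewrite ltr0n.
  have : ln K%:R <= ln (2 * y) by rewrite ler_ln ?posrE// mulr_gt0//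
    (lt_le_trans ltr01).
  have y0 : 0 < y by lra.
  have -> : ln (2 * y) = ln 2 + 5 * (ln M + ln (2 * l) + l).
    rewrite lnM ?posrE//; congr (_ + _); rewrite /y lnXn// -[LHS]mulr_natl.
    have l20 : 0 < 2 * l by rewrite mulr_gt0.
    have Ml20 : 0 < M * (2 * l) by rewrite mulr_gt0.
    by rewrite lnM ?posrE ?invr_gt0// (lnM (x := M)) ?posrE// lnV ?posrE// -hl.
  have h2 : ln 2 <= 1 :> R.
    by have := @le_ln1Dx R 1; rewrite (_ : 1 + 1 = 2) ?ltrN10; [apply; lra|lra].
  have hM : ln M <= 2 * N.
    have := @ln_sublinear R N N0; rewrite /M lnXn// -mulr_natl; lra.
  have h2l : ln (2 * l) <= 2 * l.
    by have := @ln_sublinear R (2 * l) (mulr_gt0 (ltr0n R 2) l0); lra.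
  move: (ln K%:R) (ln 2) (ln M) (ln (2 * l)) h2 hM h2l => *; lra.
rewrite ler_pdivrMr// mulrC.
apply: (@le_trans _ _ (e * (M * (2 * l) / e))); last by rewrite ler_pM2l.
have -> : e * (M * (2 * l) / e) = M * (2 * l) by field; rewrite gt_eqF.
have : A * (2 + ln K%:R) <= A * (3 + 10 * N + 20 * l).
  by rewrite ler_pM2l//; lra.
move=> h; rewrite mulrC (le_trans h)//.
have h3 : 3 + 10 * N + 20 * l <= 46 * (N * l).
  have : N * (1 / 2) <= N * l by rewrite ler_pM2l.
  have : 1 * l <= N * l by rewrite ler_pM2r.
  move: (N * l) => *; lra.
apply: (@le_trans _ _ (A * (46 * (N * l)))); first by rewrite ler_pM2l.
rewrite mulrCA mulrA.
apply: (@le_trans _ _ (N * (N * l))).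
  by rewrite ler_pM2r ?mulr_gt0// /N; lra.
rewrite mulrA -expr2 -/M ler_pM2l//; lra.
Qed.

End Budget.

Section AverageArithmetic.
Context {R : realType}.

(** Here [184 = 23 * 16 / 2]: the 23 comes from the telescoped potential, the 16
    from the lower bound on the smallest step size and the 1/2 from Young's
    inequality. *)
Lemma average_bound (u n t S F C H L r : R) :
  0 < u -> u ^+ 5 = n -> 0 < t -> t^-1 <= 16 * L * r * u ^+ 3 ->
  t * S <= 23 * (F + C * H) -> 0 <= S -> 0 <= F -> 0 <= C -> 0 <= H ->
  n * (u^-1 / 2) + (2 * u^-1)^-1 * S <=
  n * ((1 / 2 + 184 * L * r * (F + C)) * (1 + H) / u).
Proof.
move=> u0 <- t0 ti tS S0 F0 C0 H0.
have ti0 : 0 < t^-1 by rewrite invr_gt0.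
have h1 : S <= 23 * (F + C * H) * (16 * L * r * u ^+ 3).
  have -> : S = (t * S) * t^-1 by field; rewrite gt_eqF.
  by rewrite ler_pM ?mulr_ge0 ?(ltW t0) ?(ltW ti0).
have b0 : 0 <= 16 * L * r * u ^+ 3 by rewrite (le_trans (ltW ti0)).
have h2 : S <= 23 * ((F + C) * (1 + H)) * (16 * L * r * u ^+ 3).
  apply: (le_trans h1); rewrite ler_wpM2r// ler_wpM2l//.
  rewrite (_ : (F + C) * (1 + H) = F + C * H + (F * H + C)); last by ring.
  by rewrite lerDl addr_ge0// mulr_ge0.
apply: (@le_trans _ _ (u ^+ 5 * (u^-1 / 2) +
    u / 2 * (23 * ((F + C) * (1 + H)) * (16 * L * r * u ^+ 3)))).
  rewrite lerD2l (_ : (2 * u^-1)^-1 = u / 2); last by field; rewrite gt_eqF.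
  by rewrite ler_wpM2l// divr_ge0// ltW.
rewrite -subr_ge0 (_ : _ - _ = u ^+ 4 * H / 2); last by field; rewrite gt_eqF.
by rewrite divr_ge0// mulr_ge0// exprn_ge0// ltW.
Qed.

Lemma feas_bound (delta rho u z G r : R) : 0 < delta * rho -> 1 <= u ->
  0 <= r ->
  delta * (rho * u) * z <= G + r -> z <= (delta * rho)^-1 * (G * u^-1 + r).
Proof.
move=> dr0 u1 r0; have u0 : 0 < u by exact: lt_le_trans u1.
rewrite mulrA => h.
have -> : z = (delta * rho)^-1 * (u^-1 * (delta * rho * u * z)).
  field; rewrite (gt_eqF u0) /=.
  by move: dr0; rewrite lt_def mulf_eq0 negb_or => /andP[/andP[-> ->]].
rewrite ler_wpM2l ?invr_ge0 ?(ltW dr0)//.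
rewrite (@le_trans _ _ (u^-1 * (G + r)))//; first
  by rewrite ler_wpM2l// invr_ge0 ltW.
by rewrite mulrDr (mulrC _ G) lerD2l ler_piMl// invf_le1.
Qed.

End AverageArithmetic.

(** * The stochastic penalty gradient *)

Lemma has_mean_L1 d (S : measurableType d) (R : realType) (Q : probability S R)
    (h : S -> R) (a : R) : has_mean Q h a -> L1 Q h /\ mean Q h = a.
Proof. by move=> [Lh]; rewrite expectation.unlock /mean => ->. Qed.

Lemma L1_of_expectation_le d (S : measurableType d) (R : realType)
    (Q : probability S R) (h k : S -> R) (a : R) :
  measurable_fun [set: S] h -> (forall s, 0 <= h s) -> (forall s, h s <= k s) ->
  ('E_Q[k] <= a%:E)%E -> L1 Q h /\ mean Q h <= a.
Proof.
rewrite expectation.unlock => mh h0 hk ka; apply: L1_of_le => //.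
apply: le_trans ka; apply: ge0_le_integral_nonmeasurable => s.
  by rewrite lee_fin.
by rewrite lee_fin.
Qed.

Section Slqp.
Context {R : realType} {d m : nat}
  (f : 'rV[R]_d -> R) (c : 'rV[R]_d -> 'rV[R]_m)
  {dxi dzeta : measure_display}
  {Sxi : measurableType dxi} {Szeta : measurableType dzeta}
  (Pxi : probability Sxi R) (Pzeta : probability Szeta R)
  (tc : 'rV[R]_d -> Szeta -> 'rV[R]_m)
  (Gf : 'rV[R]_d -> Sxi -> 'rV[R]_d)
  (Gc : 'rV[R]_d -> Szeta -> 'M[R]_(m, d))
  (tc_meas : jointly_measurable_vec tc)
  (Gf_meas : jointly_measurable_vec Gf)
  (Gc_meas : jointly_measurable_mx Gc)
  (tc_mean : forall x i, has_mean Pzeta (fun z => tc x z 0 i) (c x 0 i))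
  (Gf_mean : forall x j, has_mean Pxi (fun s => Gf x s 0 j) (grad f x 0 j))
  (Gc_mean : forall x i j, has_mean Pzeta (fun z => Gc x z i j) (jac c x i j))
  (tLf tLgc tLc sf Cgc Cc tCgc tCc Cgf : R)
  (tLf_gt0 : 0 < tLf)
  (tCgc_gt0 : 0 < tCgc) (tCc_gt0 : 0 < tCc) (Cc_gt0 : 0 < Cc)
  (Gf_lip : forall x y, ('E_Pxi[(fun s => enorm (Gf x s - Gf y s) ^+ 2)%R]
      <= (tLf ^+ 2 * enorm (x - y) ^+ 2)%:E)%E)
  (Gc_lip : forall x y, ('E_Pzeta[(fun z => opnorm (Gc x z - Gc y z) ^+ 2)%R]
      <= (tLgc ^+ 2 * enorm (x - y) ^+ 2)%:E)%E)
  (tc_lip : forall x y, ('E_Pzeta[(fun z => enorm (tc x z - tc y z) ^+ 2)%R]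
      <= (tLc ^+ 2 * enorm (x - y) ^+ 2)%:E)%E)
  (Gf_var : forall x, ('E_Pxi[(fun s => enorm (Gf x s - grad f x) ^+ 2)%R]
      <= (sf ^+ 2)%:E)%E)
  (jac_bound : forall x, opnorm (jac c x) <= Cgc)
  (c_bound : forall x, enorm (c x) <= Cc)
  (Gc_bound : forall x, {ae Pzeta, forall z, opnorm (Gc x z) <= tCgc})
  (tc_bound : forall x, {ae Pzeta, forall z, enorm (tc x z) <= tCc})
  {dOm : measure_display} {Om : measurableType dOm} (P : probability Om R).

Local Notation S3 := (Sxi * Szeta * Szeta)%type.
Local Notation tG := (penalty_grad Gf Gc tc).
Local Notation GQ := (grad_penalty f c).
Local Notation Lt := (tildeL m tLf tLgc tLc tCgc tCc).

(** One draw [(xi, zeta1, zeta2)] of the samples used in an iteration. *)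
Definition is_sample (b : Om -> S3) :=
  [/\ has_law P (fun w => (b w).1.1) Pxi, has_law P (fun w => (b w).1.2) Pzeta,
      has_law P (fun w => (b w).2) Pzeta &
      indep2 P (fun w => (b w).1.2) (fun w => (b w).2)].

Lemma penalty_gradE r x s :
  tG r x s = Gf x s.1.1 + r *: (tc x s.2 *m Gc x s.1.2).
Proof. by rewrite mulmx_sum_row. Qed.

Lemma penalty_grad_coord r x s j : tG r x s 0 j =
  Gf x s.1.1 0 j + r * \sum_(i < m) Gc x s.1.2 i j * tc x s.2 0 i.
Proof.
rewrite penalty_gradE !mxE; congr (_ + _ * _).
by apply: eq_bigr => i _; rewrite mulrC.
Qed.

Lemma measurable_penalty_grad dT (T : measurableType dT) r (X : T -> 'rV[R]_d)
    (b : T -> S3) :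
  (forall j, measurable_fun [set: T] (fun t => X t 0 j)) ->
  measurable_fun [set: T] b ->
  forall j, measurable_fun [set: T] (fun t => tG r (X t) (b t) 0 j).
Proof.
move=> /measurable_rVP mX mb j; under eq_fun do rewrite penalty_grad_coord.
have mb1 : measurable_fun [set: T] (fun t => (b t).1)
  by exact: measurableT_comp mb.
have mxi : measurable_fun [set: T] (fun t => (b t).1.1)
  by exact: measurableT_comp mb1.
have mz1 : measurable_fun [set: T] (fun t => (b t).1.2)
  by exact: measurableT_comp mb1.
have mz2 : measurable_fun [set: T] (fun t => (b t).2)
  by exact: measurableT_comp mb.
apply: measurable_funD.
  exact: (measurableT_comp (Gf_meas j) (measurable_fun_pair mX mxi)).
apply: measurable_funM => //; apply: measurable_sum => i;
  apply: measurable_funM.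
  exact: (measurableT_comp (Gc_meas i j) (measurable_fun_pair mX mz1)).
exact: (measurableT_comp (tc_meas i) (measurable_fun_pair mX mz2)).
Qed.

Lemma sqr_tildeL : Lt ^+ 2 =
  4 * tLf ^+ 2 + 4 * m%:R ^+ 2 * (tCc ^+ 2 * tLgc ^+ 2 + tCgc ^+ 2 * tLc ^+ 2).
Proof.
by rewrite sqr_sqrtr// !(sqr_ge0, addr_ge0, mulr_ge0).
Qed.

Lemma tildeL_gt0 : 0 < Lt.
Proof.
rewrite sqrtr_gt0 ltr_pwDl//; first by rewrite mulr_gt0// exprn_gt0.
by rewrite !(sqr_ge0, addr_ge0, mulr_ge0).
Qed.

Section Sample.
Context (b : Om -> S3) (bS : is_sample b).

Lemma sample_measurable : measurable_fun [set: Om] b.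
Proof.
have [[m1 _] [m2 _] [m3 _] _] := bS.
have := measurable_fun_pair (measurable_fun_pair m1 m2) m3.
by apply: eq_measurable_fun => w _; case: (b w) => -[].
Qed.

(** Unbiasedness of the product term is where the independence of the two
    samples [zeta1] and [zeta2] enters. *)
Lemma mean_penalty_grad r x j :
  L1 P (fun w => tG r x (b w) 0 j) /\
  mean P (fun w => tG r x (b w) 0 j) = GQ r x 0 j.
Proof.
have [lxi l1 l2 i12] := bS.
have [Lf Mf] := has_mean_L1 (Gf_mean x j).
have H i : L1 P (fun w => Gc x (b w).1.2 i j * tc x (b w).2 0 i) /\
    mean P (fun w => Gc x (b w).1.2 i j * tc x (b w).2 0 i)
      = jac c x i j * c x 0 i.
  have [L1i M1] := has_mean_L1 (Gc_mean x i j).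
  have [L2i M2] := has_mean_L1 (tc_mean x i).
  have [LL ->] := mean_mul_indep l1 l2 i12 L1i L2i.
  by rewrite M1 M2.
have Lfw := L1_law lxi Lf.
have Ls : L1 P (fun w => \sum_(i < m) Gc x (b w).1.2 i j * tc x (b w).2 0 i).
  by apply: L1_sum => i; exact: (H i).1.
have Lr := L1Z r Ls.
under eq_fun do rewrite penalty_grad_coord.
split; first exact: L1D.
rewrite (meanD Lfw Lr) (mean_law lxi Lf) Mf (meanZ r Ls) !mxE;
  congr (_ + _ * _).
rewrite mean_sum => [|i]; last exact: (H i).1.
by apply: eq_bigr => i _; rewrite (H i).2 mulrC.
Qed.

Lemma penalty_grad_lip_pointwise r x y s :
  enorm (tG r x s - tG r y s) ^+ 2 <=
    2 * enorm (Gf x s.1.1 - Gf y s.1.1) ^+ 2 +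
    4 * r ^+ 2 * (enorm (tc x s.2) ^+ 2 *
        \sum_(i < m) enorm (row i (Gc x s.1.2 - Gc y s.1.2)) ^+ 2 +
      opnorm (Gc y s.1.2) ^+ 2 * enorm (tc x s.2 - tc y s.2) ^+ 2).
Proof.
rewrite !penalty_gradE.
set u := Gf x _; set u' := Gf y _; set t := tc x _; set t' := tc y _.
set G := Gc x _; set G' := Gc y _.
have -> : u + r *: (t *m G) - (u' + r *: (t' *m G')) =
    (u - u') + r *: (t *m (G - G') + (t - t') *m G').
  by rewrite mulmxBr mulmxBl addrA subrK scalerBr opprD addrACA.
apply: (le_trans (sqr_enormD_le _ _)); rewrite lerD2l enormZ exprMn.
rewrite real_normK ?num_real//.
have h1 := sqr_enorm_mulmx t (G - G').
have h2 : enorm ((t - t') *m G') ^+ 2 <= opnorm G' ^+ 2 * enorm (t - t') ^+ 2.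
  rewrite -exprMn ler_sqr ?nnegrE ?mulr_ge0 ?enorm_ge0 ?opnorm_ge0//.
  by rewrite mulrC enorm_mulmx_le.
have h3 := sqr_enormD_le (t *m (G - G')) ((t - t') *m G').
rewrite mulrCA -subr_ge0.
set A := enorm (_ + _) ^+ 2 in h3 *; set B1 := _ * \sum_(_ < _) _ in h1 *.
set B2 := opnorm _ ^+ 2 * _ in h2 *.
have -> : 4 * r ^+ 2 * (B1 + B2) - r ^+ 2 * (2 * A) =
  r ^+ 2 * (2 * (2 * B1 + 2 * B2 - A)) by ring.
by rewrite mulr_ge0 ?sqr_ge0// mulr_ge0// subr_ge0; lra.
Qed.

Lemma L1_diff_Gf x y :
  L1 Pxi (fun s => enorm (Gf x s - Gf y s) ^+ 2) /\
  mean Pxi (fun s => enorm (Gf x s - Gf y s) ^+ 2)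
    <= tLf ^+ 2 * enorm (x - y) ^+ 2.
Proof.
apply: L1_of_expectation_le (Gf_lip x y) => [|s|s]; last by [].
  apply: measurable_sqr_enorm => j; under eq_fun do rewrite !mxE.
  by apply: measurable_funB; apply: L1_measurable (has_mean_L1 (Gf_mean _ _)).1.
exact: sqr_ge0.
Qed.

Lemma L1_diff_tc x y :
  L1 Pzeta (fun z => enorm (tc x z - tc y z) ^+ 2) /\
  mean Pzeta (fun z => enorm (tc x z - tc y z) ^+ 2) <=
    m%:R ^+ 2 * (tLc ^+ 2 * enorm (x - y) ^+ 2).
Proof.
have [L le1] : L1 Pzeta (fun z => enorm (tc x z - tc y z) ^+ 2) /\
    mean Pzeta (fun z => enorm (tc x z - tc y z) ^+ 2) <=
      tLc ^+ 2 * enorm (x - y) ^+ 2.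
  apply: L1_of_expectation_le (tc_lip x y) => [|s|s]; last by [].
    apply: measurable_sqr_enorm => j; under eq_fun do rewrite !mxE.
    by apply: measurable_funB; apply: L1_measurable (has_mean_L1 (tc_mean _
      _)).1.
  exact: sqr_ge0.
(* the factor [m^2], which is that of [tildeL], is harmless: it is at least 1
   unless there are no constraints at all *)
split => //; have [m0|m0] := posnP m; last first.
  apply: (le_trans le1); rewrite ler_peMl ?(sqr_ge0, mulr_ge0)//.
  by rewrite exprn_ege1// ler1n.
have -> : m%:R = 0 :> R by rewrite m0.
rewrite expr0n mul0r.
under eq_fun => z.
  rewrite sqr_enorm_sum big1; first over.
  by move=> i; have := ltn_ord i; rewrite [X in (_ < X)%N]m0.
by rewrite mean_cst.
Qed.

Lemma L1_diff_row_Gc x y i :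
  L1 Pzeta (fun z => enorm (row i (Gc x z - Gc y z)) ^+ 2) /\
  mean Pzeta (fun z => enorm (row i (Gc x z - Gc y z)) ^+ 2) <=
    tLgc ^+ 2 * enorm (x - y) ^+ 2.
Proof.
apply: L1_of_expectation_le (Gc_lip x y) => [|s|s].
- apply: measurable_sqr_enorm => j; under eq_fun do rewrite !mxE.
  by apply: measurable_funB; apply: L1_measurable (has_mean_L1 (Gc_mean _ _
    _)).1.
- exact: sqr_ge0.
- by rewrite ler_sqr ?nnegrE ?enorm_ge0 ?opnorm_ge0// enorm_row_le.
Qed.

(** Expected smoothness. The sum over rows replaces the operator norm by the
    Frobenius norm and costs the factor [m]. *)
Lemma penalty_grad_lip r x y : 1 <= r ->
  L1 P (fun w => enorm (tG r x (b w) - tG r y (b w)) ^+ 2) /\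
  mean P (fun w => enorm (tG r x (b w) - tG r y (b w)) ^+ 2) <=
    Lt ^+ 2 * r ^+ 2 * enorm (x - y) ^+ 2.
Proof.
move=> r1; have [lxi l1 l2 _] := bS; have mb := sample_measurable.
have [LA0 A0] := L1_diff_Gf x y; have LA := L1_law lxi LA0.
have [LC0 C0] := L1_diff_tc x y; have LC := L1_law l2 LC0.
have LB i := L1_law l1 (L1_diff_row_Gc x y i).1.
rewrite -(mean_law lxi LA0) in A0; rewrite -(mean_law l2 LC0) in C0.
have B0 i : mean P (fun w => enorm (row i (Gc x (b w).1.2 - Gc y (b w).1.2)) ^+
  2)
    <= tLgc ^+ 2 * enorm (x - y) ^+ 2.
  have [h1 h2] := L1_diff_row_Gc x y i.
  by rewrite (mean_law l1 h1).
have LBs := L1_sum LB.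
pose A w := enorm (Gf x (b w).1.1 - Gf y (b w).1.1) ^+ 2.
pose Bs w := \sum_(i < m) enorm (row i (Gc x (b w).1.2 - Gc y (b w).1.2)) ^+ 2.
pose C w := enorm (tc x (b w).2 - tc y (b w).2) ^+ 2.
pose H w := 2 * A w + (4 * r ^+ 2) * (tCc ^+ 2 * Bs w + tCgc ^+ 2 * C w).
have LBC : L1 P (fun w => tCc ^+ 2 * Bs w + tCgc ^+ 2 * C w).
  by apply: L1D; exact: L1Z.
have LH : L1 P H by apply: L1D; exact: L1Z.
have aeH : {ae P, forall w, enorm (tG r x (b w) - tG r y (b w)) ^+ 2 <= H w}.
  have aec := ae_law l2 (tc_bound x); have aeG := ae_law l1 (Gc_bound y).
  apply: filterS2 aec aeG => w hc hG.
  apply: (le_trans (penalty_grad_lip_pointwise _ _ _ _)).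
  rewrite lerD2l ler_wpM2l ?(sqr_ge0, mulr_ge0)// lerD//.
    rewrite ler_wpM2r ?sumr_ge0// => [i _|]; first exact: sqr_ge0.
    by rewrite ler_sqr ?nnegrE ?enorm_ge0// ltW.
  rewrite ler_wpM2r ?sqr_ge0//.
  by rewrite ler_sqr ?nnegrE ?opnorm_ge0// ltW.
have Ld : L1 P (fun w => enorm (tG r x (b w) - tG r y (b w)) ^+ 2).
  apply: (L1_le _ LH).
    apply: measurable_sqr_enorm => j; under eq_fun do rewrite rV_coordB.
    have h z := @measurable_penalty_grad _ Om r (fun=> z) b
      (fun j => measurable_cst (z 0 j)) mb j.
    exact: measurable_funB (h x) (h y).
  by apply: filterS aeH => w; rewrite ger0_norm ?sqr_ge0.
split => //; apply: (le_trans (mean_le Ld LH aeH)).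
have LA' := L1Z 2 LA; have LBC' := L1Z (4 * r ^+ 2) LBC.
have -> : mean P H = 2 * mean P A + 4 * r ^+ 2 *
    (tCc ^+ 2 * mean P Bs + tCgc ^+ 2 * mean P C).
  rewrite /H (meanD LA' LBC') (meanZ _ LA) (meanZ _ LBC).
  by rewrite (meanD (L1Z _ LBs) (L1Z _ LC)) (meanZ _ LBs) (meanZ _ LC).
set D := enorm (x - y) ^+ 2 in A0 B0 C0 *; have D0 : 0 <= D by exact: sqr_ge0.
have Bs0 : mean P Bs <= m%:R ^+ 2 * (tLgc ^+ 2 * D).
  rewrite /Bs mean_sum//.
  apply: (@le_trans _ _ (\sum_(i < m) (tLgc ^+ 2 * D)));
    first by apply: ler_sum.
  rewrite sumr_const card_ord -[leLHS]mulr_natl ler_wpM2r ?(sqr_ge0,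
    mulr_ge0)//.
  by rewrite -natrX ler_nat -{1}(expn1 m); case: (m) => // k;
    rewrite leq_pexp2l.
have r2 : 1 <= r ^+ 2 by rewrite exprn_ege1// ltW// (lt_le_trans ltr01).
rewrite sqr_tildeL.
apply: (@le_trans _ _ (2 * (tLf ^+ 2 * D) + 4 * r ^+ 2 *
  (tCc ^+ 2 * (m%:R ^+ 2 * (tLgc ^+ 2 * D)) +
   tCgc ^+ 2 * (m%:R ^+ 2 * (tLc ^+ 2 * D))))).
  apply: lerD; first by rewrite ler_wpM2l.
  rewrite ler_wpM2l ?(sqr_ge0, mulr_ge0)//.
  by apply: lerD; rewrite ler_wpM2l ?sqr_ge0.
rewrite -subr_ge0 (_ : _ - _ = tLf ^+ 2 * D * (4 * r ^+ 2 - 2)); last by ring.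
rewrite mulr_ge0 ?(sqr_ge0, mulr_ge0)//; lra.
Qed.

Lemma sqr_enorm_mulmx_bound k l (t : 'rV[R]_k) (G : 'M[R]_(k, l)) (a e : R) :
  enorm t <= a -> opnorm G <= e -> enorm (t *m G) ^+ 2 <= (a * e) ^+ 2.
Proof.
move=> ta Ge; have a0 := le_trans (enorm_ge0 t) ta.
have e0 := le_trans (opnorm_ge0 G) Ge.
rewrite ler_sqr ?nnegrE ?enorm_ge0 ?mulr_ge0//.
by rewrite (le_trans (enorm_mulmx_le _ _))// ler_pM ?enorm_ge0 ?opnorm_ge0.
Qed.

(** Variance bound for the stochastic penalty gradient; the product term is
    controlled by the almost sure bounds on its two factors. *)
Definition noise_bound r :=
  2 * sf ^+ 2 + 4 * r ^+ 2 * ((tCc * tCgc) ^+ 2 + (Cc * Cgc) ^+ 2).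

Lemma penalty_grad_var r x :
  L1 P (fun w => enorm (tG r x (b w) - GQ r x) ^+ 2) /\
  mean P (fun w => enorm (tG r x (b w) - GQ r x) ^+ 2) <= noise_bound r.
Proof.
have [lxi l1 l2 _] := bS; have mb := sample_measurable.
have [LA0 A0] : L1 Pxi (fun s => enorm (Gf x s - grad f x) ^+ 2) /\
    mean Pxi (fun s => enorm (Gf x s - grad f x) ^+ 2) <= sf ^+ 2.
  apply: L1_of_expectation_le (Gf_var x) => [|s|s]; last by [].
    apply: measurable_sqr_enorm => j; under eq_fun do rewrite !mxE.
    apply: measurable_funB => //.
    by apply: L1_measurable (has_mean_L1 (Gf_mean _ _)).1.
  exact: sqr_ge0.
have LA := L1_law lxi LA0; rewrite -(mean_law lxi LA0) in A0.
pose e := 4 * r ^+ 2 * ((tCc * tCgc) ^+ 2 + (Cc * Cgc) ^+ 2).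
pose H w := 2 * enorm (Gf x (b w).1.1 - grad f x) ^+ 2 + e.
have LH : L1 P H by apply: L1D; [exact: L1Z|exact: L1_cst].
have aeH : {ae P, forall w, enorm (tG r x (b w) - GQ r x) ^+ 2 <= H w}.
  have aec := ae_law l2 (tc_bound x); have aeG := ae_law l1 (Gc_bound x).
  apply: filterS2 aec aeG => w hc hG; rewrite penalty_gradE /grad_penalty.
  set t := tc x _ in hc *; set G := Gc x _ in hG *; set u := Gf x _.
  have -> : u + r *: (t *m G) - (grad f x + r *: (c x *m jac c x)) =
      (u - grad f x) + r *: (t *m G - c x *m jac c x).
    by rewrite scalerBr opprD addrACA.
  apply: (le_trans (sqr_enormD_le _ _)); rewrite lerD2l enormZ exprMn.
  rewrite real_normK ?num_real//.
  have := sqr_enormD_le (t *m G) (- (c x *m jac c x)); rewrite enormN => h3.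
  have h1 := sqr_enorm_mulmx_bound hc hG.
  have h2 := sqr_enorm_mulmx_bound (c_bound x) (jac_bound x).
  rewrite /e (_ : 4 * _ * _ = 2 * (r ^+ 2 *
    (2 * (tCc * tCgc) ^+ 2 + 2 * (Cc * Cgc) ^+ 2))); last by ring.
  rewrite ler_wpM2l// ler_wpM2l ?sqr_ge0//.
  by apply: (le_trans h3); apply: lerD; rewrite ler_wpM2l.
have Ld : L1 P (fun w => enorm (tG r x (b w) - GQ r x) ^+ 2).
  apply: (L1_le _ LH).
    apply: measurable_sqr_enorm => j; under eq_fun do rewrite rV_coordB.
    have h z := @measurable_penalty_grad _ Om r (fun=> z) b
      (fun j => measurable_cst (z 0 j)) mb j.
    exact: measurable_funB (h x) (measurable_cst (GQ r x 0 j)).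
  by apply: filterS aeH => w; rewrite ger0_norm ?sqr_ge0.
split => //; apply: (le_trans (mean_le Ld LH aeH)).
rewrite /H (meanD (L1Z 2 LA) (L1_cst P e)) (meanZ _ LA) mean_cst lerD2r.
by rewrite ler_wpM2l.
Qed.

(** The mean of the stochastic gradients inherits their expected smoothness. *)
Lemma grad_penalty_lip r x y : 1 <= r ->
  enorm (GQ r x - GQ r y) <= Lt * r * enorm (x - y).
Proof.
move=> r1; have r0 : 0 <= r by exact: le_trans r1.
have [L le1] := penalty_grad_lip x y r1.
have LtP := ltW tildeL_gt0.
rewrite -ler_sqr ?nnegrE ?mulr_ge0 ?enorm_ge0// !exprMn (le_trans _ le1)//.
apply: sqr_enorm_mean_le => // j; rewrite rV_coordB.
have [Lx Mx] := mean_penalty_grad r x j; have [Ly My] := mean_penalty_grad r y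
  j.
under eq_fun do rewrite rV_coordB.
by split; [exact: L1B|rewrite meanB// Mx My].
Qed.

End Sample.

(** * The run *)

Section Run.
Context (X : set 'rV[R]_d) (closedX : closed X) (convexX : convex_set X)
  (f_diff : forall x, differentiable f x)
  (c_diff : forall x, differentiable c x)
  (Bf Qlow delta : R)
  (Cgf_gt0 : 0 < Cgf) (delta_gt0 : 0 < delta)
  (gradf_bound : forall x, enorm (grad f x) <= Cgf)
  (Q_bound : forall r x, 0 < r -> Qlow <= penalty f c r x)
  (B : nat -> Om -> S3) (BS : forall k, (1 <= k)%N -> is_sample (B k))
  (B_indep : mutually_indep P (fun k => B k.+1))
  (rho : R) (rho_gt1 : 1 < rho)
  (x1 : 'rV[R]_d) (x1X : X x1)
  (x g : nat -> Om -> 'rV[R]_d)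
  (run : forall w, slqp_run X Gf Gc tc
     (step_eta Lt rho) (step_rho rho) step_alpha
     x1 (B ^~ w) (x ^~ w) (g ^~ w))
  (f_bound : forall k, (1 <= k)%N -> {ae P, forall w, `|f (x k w)| <= Bf})
  (regularity : forall k, (1 <= k)%N -> {ae P, forall w,
     delta * enorm (c (x k w)) <=
     dist (c (x k w) *m jac c (x k w)) (neg_set (normal_cone X (x k w)))}).

Local Notation eta := (step_eta Lt rho).
Local Notation rk := (step_rho rho).
Local Notation al := (@step_alpha R).

Let rho_gt0 : 0 < rho := lt_trans ltr01 rho_gt1.

Lemma rk_ge1 k : (1 <= k)%N -> 1 <= rk k.
Proof.
move=> k1; rewrite step_rhoE -[leLHS]mul1r ler_pM// ?(ltW rho_gt1)//.
exact: root5_ge1.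
Qed.

Lemma eta_gt0 k : 0 < eta k.
Proof.
have u0 : 0 < root5 k.+1 :> R by rewrite (lt_le_trans ltr01)// root5_ge1.
by rewrite step_etaE invr_gt0 mulr_gt0 ?exprn_gt0// mulr_gt0// mulr_gt0//
  tildeL_gt0.
Qed.

Lemma x_mem k w : (1 <= k)%N -> X (x k w).
Proof.
have [e1 _ rec] := run w.
case: k => // -[_|k _]; first by rewrite e1.
have [-> _] := rec k.+1 isT; exact: proj_mem x1X _.
Qed.

Lemma xS k w : (1 <= k)%N -> x k.+1 w = proj X (x k w - eta k *: g k w).
Proof. by move=> k1; have [_ _ /(_ k k1) []] := run w. Qed.

Lemma gS k w : (1 <= k)%N -> g k.+1 w = tG (rk k.+1) (x k.+1 w) (B k.+1 w)
  + (1 - al k.+1) *: (g k w - tG (rk k) (x k w) (B k.+1 w)).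
Proof. by move=> k1; have [_ _ /(_ k k1) []] := run w. Qed.

Lemma continuous_grad_penalty r j : 1 <= r -> continuous (fun y => GQ r y 0 j).
Proof.
move=> r1; apply: (@coord_lipschitz_continuous _ _ _ _ (Lt * r)) => y z.
exact: (grad_penalty_lip (BS (leqnn 1)) y z r1).
Qed.

(** The iterates are Borel functions of the samples drawn so far. The
    sigma-algebra on the sample space is left arbitrary, in order to apply this
    to the one generated by the past. *)
Lemma run_measurable dT (T : measurableType dT) (b : nat -> T -> S3)
    (y h : nat -> T -> 'rV[R]_d) (n : nat) :
  (forall w, slqp_run X Gf Gc tc eta rk al x1 (b ^~ w) (y ^~ w) (h ^~ w)) ->
  (forall k, (1 <= k <= n)%N -> measurable_fun [set: T] (b k)) -> (1 <= n)%N ->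
  (forall j, measurable_fun [set: T] (fun w => y n w 0 j)) /\
  (forall j, measurable_fun [set: T] (fun w => h n w 0 j)).
Proof.
move=> runb; elim: n => // -[_ mb _|n ih mb _].
  have mb1 : measurable_fun [set: T] (b 1) by exact: mb.
  have ey w : y 1 w = x1 by have [-> _ _] := runb w.
  have my j : measurable_fun [set: T] (fun w => y 1 w 0 j).
    by under eq_fun do rewrite ey; exact: measurable_cst.
  split => // j.
  have eh w : h 1 w = tG (rk 1) (y 1 w) (b 1 w) by have [_ -> _] := runb w.
  under eq_fun do rewrite eh; exact: measurable_penalty_grad.
have [my mh] : (forall j, measurable_fun [set: T] (fun w => y n.+1 w 0 j)) /\
    (forall j, measurable_fun [set: T] (fun w => h n.+1 w 0 j)).
  by apply: ih => // k /andP[k1 kn]; apply: mb; rewrite k1 ltnW.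
have mbS : measurable_fun [set: T] (b n.+2) by apply: mb; rewrite leqnn.
have ey w : y n.+2 w = proj X (y n.+1 w - eta n.+1 *: h n.+1 w).
  by have [_ _ /(_ n.+1 isT) []] := runb w.
have eh w : h n.+2 w = tG (rk n.+2) (y n.+2 w) (b n.+2 w)
    + (1 - al n.+2) *: (h n.+1 w - tG (rk n.+1) (y n.+1 w) (b n.+2 w)).
  by have [_ _ /(_ n.+1 isT) []] := runb w.
have myS j : measurable_fun [set: T] (fun w => y n.+2 w 0 j).
  under eq_fun do rewrite ey.
  have mp := continuous_borel_measurable
    (continuous_proj_coord closedX convexX x1X (j := j)).
  have mz : measurable_fun [set: T]
      ((fun w => y n.+1 w - eta n.+1 *: h n.+1 w) : T -> borel_rV d).
    apply: measurable_rV => i; under eq_fun do rewrite rV_coordB rV_coordZ.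
    by apply: measurable_funB => //; exact: measurable_funM.
  exact: (measurableT_comp mp mz).
split => // j; under eq_fun do rewrite eh rV_coordD rV_coordZ rV_coordB.
apply: measurable_funD; first exact: measurable_penalty_grad.
apply: measurable_funM => //; apply: measurable_funB => //.
exact: measurable_penalty_grad.
Qed.

Lemma measurable_B k : (1 <= k)%N -> measurable_fun [set: Om] (B k).
Proof. by move=> k1; exact: sample_measurable (BS k1). Qed.

Lemma measurable_x k j : (1 <= k)%N -> measurable_fun [set: Om] (fun w => x k w
  0 j).
Proof.
move=> k1; apply: (run_measurable run _ k1).1 => i /andP[i1 _].
exact: measurable_B.
Qed.

Lemma measurable_g k j : (1 <= k)%N -> measurable_fun [set: Om] (fun w => g k w
  0 j).
Proof.
move=> k1; apply: (run_measurable run _ k1).2 => i /andP[i1 _].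
exact: measurable_B.
Qed.

Definition past n (w : Om) : borel_rV d * borel_rV d := (x n w, g n w).

Lemma measurable_past n : (1 <= n)%N -> measurable_fun [set: Om] (past n).
Proof.
move=> n1; apply: measurable_fun_pair; apply: measurable_rV => j.
  exact: measurable_x.
exact: measurable_g.
Qed.

(** The pair [(x n, g n)] is measurable already for the sigma-algebra generated by
    the first [n] samples, put on the same sample space. *)
Lemma past_indep n : (1 <= n)%N -> indep2 P (past n) (B n.+1).
Proof.
move=> n1 A C mA mC.
pose Z k := B k.+1.
have mZ k : measurable_fun [set: Om] (Z k) by exact: measurable_B.
apply: (cylinder_indep mZ B_indep) => //.
pose T := g_sigma_algebraType (cylinder Z n).
have mb k : (1 <= k <= n)%N -> measurable_fun [set: T] (B k : T -> S3).
  case: k => // k /= kn _ D mD; rewrite setTI; apply: sub_sigma_algebra.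
  exists (fun i => if i == k then D else setT); split.
    by move=> i; case: ifP.
  apply/seteqP; split => w /= h.
    by move=> i _ /=; case: eqP => [->|].
  by have := h k kn; rewrite /= eqxx.
have [mx mg] := @run_measurable _ T B x g n run mb n1.
have : measurable_fun [set: T] (past n : T -> borel_rV d * borel_rV d).
  by apply: measurable_fun_pair; apply: measurable_rV.
by move=> /(_ measurableT _ mA); rewrite setTI.
Qed.


Lemma split_bound (s p q q' t : R) : s <= 2 * p + 2 * q -> q <= q' -> t <= s ->
  2 * t <= 4 * p + 4 * q'.
Proof. lra. Qed.

(** Conditionally on the past, the new momentum error is the contracted old one
    plus a centred term. Measuring the latter around [a * GQ r' y'] splits it
    into the fresh noise, damped by [a], and the change of the stochastic
    gradient between the two iterates under the same sample. *)
Lemma momentum_inner b r r' (y y' h : 'rV[R]_d) (a : R) :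
  is_sample b -> 1 <= r -> 1 <= r' -> 0 <= a -> a <= 1 ->
  L1 P (fun w => enorm (tG r' y' (b w) + (1 - a) *: (h - tG r y (b w))
    - GQ r' y') ^+ 2) /\
  mean P (fun w => enorm (tG r' y' (b w) + (1 - a) *: (h - tG r y (b w))
    - GQ r' y') ^+ 2) <=
  (1 - a) ^+ 2 * enorm (h - GQ r y) ^+ 2 +
  (2 * a ^+ 2 * noise_bound r' + 4 * (r' - r) ^+ 2 * (tCc * tCgc) ^+ 2) +
  4 * Lt ^+ 2 * r ^+ 2 * enorm (y' - y) ^+ 2.
Proof.
move=> bS r1 r'1 a0 a1.
pose W w := tG r' y' (b w) - (1 - a) *: tG r y (b w).
pose mu := GQ r' y' - (1 - a) *: GQ r y.
pose nu := a *: GQ r' y'.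
pose a' := (1 - a) *: (h - GQ r y).
have hW j : L1 P (fun w => W w 0 j) /\ mean P (fun w => W w 0 j) = mu 0 j.
  have [L' M'] := mean_penalty_grad bS r' y' j.
  have [L M] := mean_penalty_grad bS r y j.
  have LZ := L1Z (1 - a) L.
  rewrite /W /mu; under eq_fun do rewrite rV_coordB rV_coordZ.
  by rewrite rV_coordB rV_coordZ; split; [exact: L1B|rewrite meanB// meanZ//
    M' M].
have [Ln Mn] := penalty_grad_var bS r' y'.
have [Ll Ml] := penalty_grad_lip bS y' y r1.
pose e := 4 * (r' - r) ^+ 2 * (tCc * tCgc) ^+ 2.
pose H w := 2 * a ^+ 2 * enorm (tG r' y' (b w) - GQ r' y') ^+ 2 +
  4 * enorm (tG r y' (b w) - tG r y (b w)) ^+ 2 + e.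
have L12 := L1D (L1Z (2 * a ^+ 2) Ln) (L1Z 4 Ll).
have LH : L1 P H by apply: L1D => //; exact: L1_cst.
have aeH : {ae P, forall w, enorm (W w - nu) ^+ 2 <= H w}.
  have [lxi l1 l2 _] := bS.
  have aec := ae_law l2 (tc_bound y'); have aeG := ae_law l1 (Gc_bound y').
  apply: filterS2 aec aeG => w hc hG; rewrite /H /W /nu.
  set t := tc y' _ in hc *; set G := Gc y' _ in hG *.
  have drift : tG r' y' (b w) = tG r y' (b w) + (r' - r) *: (t *m G).
    by rewrite !penalty_gradE -addrA -scalerDl [r + _]addrC subrK.
  set u' := tG r' y' (b w) in drift *; set u := tG r y' (b w) in drift *.
  set v := tG r y (b w); set q := GQ r' y'.
  have -> : u' - (1 - a) *: v - a *: q =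
      a *: (u' - q) + (1 - a) *: ((u - v) + (r' - r) *: (t *m G)).
    have -> : (u - v) + (r' - r) *: (t *m G) = u' - v by rewrite drift addrAC.
    rewrite !scalerBr addrACA -scalerDl [a + _]addrC subrK scale1r addrA.
    by rewrite [RHS]addrAC.
  have h1 := sqr_enormD_le (a *: (u' - q))
    ((1 - a) *: ((u - v) + (r' - r) *: (t *m G))).
  have h2 := sqr_enormD_le (u - v) ((r' - r) *: (t *m G)).
  have h3 := sqr_enorm_mulmx_bound hc hG.
  apply: (le_trans h1).
  rewrite !enormZ !exprMn !real_normK ?num_real// in h2 *.
  have a2 : (1 - a) ^+ 2 <= 1 by rewrite exprn_ile1 ?subr_ge0// gerBl.
  have h4 : (r' - r) ^+ 2 * enorm (t *m G) ^+ 2 <= (r' - r) ^+ 2 * (tCc * tCgc)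
    ^+ 2.
    by rewrite ler_wpM2l ?sqr_ge0.
  have h5 : (1 - a) ^+ 2 * enorm (u - v + (r' - r) *: (t *m G)) ^+ 2 <=
      enorm (u - v + (r' - r) *: (t *m G)) ^+ 2 by rewrite ler_piMl ?sqr_ge0.
  rewrite -[leRHS]addrA; apply: lerD; first by rewrite mulrA.
  by rewrite /e -(mulrA 4 ((r' - r) ^+ 2)); exact: split_bound h2 h4 h5.
have mW : measurable_fun [set: Om] (fun w => enorm (W w - nu) ^+ 2).
  apply: measurable_sqr_enorm => j; under eq_fun do rewrite rV_coordB.
  by apply: measurable_funB => //; exact: L1_measurable (hW j).1.
have L2 : L1 P (fun w => enorm (W w - nu) ^+ 2).
  by apply: (L1_le mW LH); apply: filterS aeH => w; rewrite ger0_norm ?sqr_ge0.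
have [L3 M3] := second_moment_shift a' hW L2.
have E w : tG r' y' (b w) + (1 - a) *: (h - tG r y (b w)) - GQ r' y' =
    a' + (W w - mu).
  rewrite /a' /W /mu.
  move: (tG r' y' (b w)) (tG r y (b w)) (GQ r' y') (GQ r y) => p1 p2 p3 p4.
  by apply/rowP => j; rewrite !mxE; ring.
under eq_fun do rewrite E.
split => //; rewrite M3 /a' enormZ exprMn real_normK ?num_real//.
rewrite -[leLHS]addrA -[leRHS]addrA lerD2l.
apply: (@le_trans _ _ (mean P H)).
  by rewrite (le_trans _ (mean_le L2 LH aeH))// gerBl sqr_ge0.
rewrite /H (meanD L12 (L1_cst P e)) (meanD (L1Z (2 * a ^+ 2) Ln) (L1Z 4 Ll)).
rewrite (meanZ _ Ln) (meanZ _ Ll) mean_cst -/e addrAC lerD//.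
  by rewrite lerD2r ler_wpM2l// mulr_ge0// sqr_ge0.
by rewrite -!(mulrA 4) ler_wpM2l// mulrA.
Qed.

(** * One iteration *)

Definition err k w := g k w - GQ (rk k) (x k w).
Definition step k w := x k.+1 w - x k w.

Lemma measurable_step k j : (1 <= k)%N ->
  measurable_fun [set: Om] (fun w => step k w 0 j).
Proof.
move=> k1; rewrite /step; under eq_fun do rewrite rV_coordB.
by apply: measurable_funB; exact: measurable_x.
Qed.

(** The iterate [x k] is its own projection, so this is nonexpansiveness. *)
Lemma enorm_step_le k w : (1 <= k)%N -> enorm (step k w) <= eta k * enorm (g k
  w).
Proof.
move=> k1; rewrite /step xS//.
have xX := x_mem w k1.
have fixp : proj X (x k w) = x k w.
  have := proj_obtuse closedX convexX x1X (x k w) xX.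
  rewrite -sqr_enorm => h; apply/esym/eqP; rewrite -subr_eq0; apply/eqP.
  apply: enorm_eq0; apply/eqP; rewrite -sqrf_eq0 eq_le h; exact: sqr_ge0.
rewrite -{2}fixp (le_trans (proj_nonexpansive closedX convexX x1X _ _))//.
have -> : x k w - eta k *: g k w - x k w = - (eta k *: g k w).
  by rewrite addrC addKr.
by rewrite enormN enormZ ger0_norm ?(ltW (eta_gt0 k)).
Qed.

Lemma enorm_grad_penalty_le r y : 0 <= r -> enorm (GQ r y) <= Cgf + r * (Cc *
  Cgc).
Proof.
move=> r0; rewrite (le_trans (enormD _ _))// lerD// enormZ ger0_norm//.
rewrite ler_wpM2l// (le_trans (enorm_mulmx_le _ _))//.
by rewrite ler_pM ?enorm_ge0 ?opnorm_ge0.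
Qed.

Lemma L1_step k : (1 <= k)%N -> L1 P (fun w => enorm (err k w) ^+ 2) ->
  L1 P (fun w => enorm (step k w) ^+ 2).
Proof.
move=> k1 Le; pose b := Cgf + rk k * (Cc * Cgc).
have L : L1 P (fun w => eta k ^+ 2 * (2 * enorm (err k w) ^+ 2 + 2 * b ^+ 2)).
  by apply: L1Z; apply: L1D; [exact: L1Z|exact: L1_cst].
apply: (L1_le _ L).
  by apply: measurable_sqr_enorm => j; exact: measurable_step.
apply/aeW => w; rewrite ger0_norm ?sqr_ge0//.
apply: (@le_trans _ _ ((eta k * enorm (g k w)) ^+ 2)).
  rewrite ler_sqr ?nnegrE ?enorm_ge0 ?enorm_step_le//.
  by rewrite mulr_ge0 ?enorm_ge0// ltW// eta_gt0.
rewrite exprMn ler_wpM2l ?sqr_ge0//.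
have -> : g k w = err k w + GQ (rk k) (x k w) by rewrite subrK.
rewrite (le_trans (sqr_enormD_le _ _))// lerD2l ler_wpM2l//.
have rk0 : 0 <= rk k := le_trans ler01 (rk_ge1 k1).
have := enorm_grad_penalty_le (x k w) rk0; rewrite -/b => hb.
by rewrite ler_sqr ?nnegrE ?enorm_ge0 ?(le_trans _ hb)// enorm_ge0.
Qed.

Definition noise k := 2 * al k.+1 ^+ 2 * noise_bound (rk k.+1) +
  4 * (rk k.+1 - rk k) ^+ 2 * (tCc * tCgc) ^+ 2.

Lemma alpha_le1 k : 0 <= al k.+1 <= 1.
Proof.
have u1 : 1 <= root5 k.+1 :> R by rewrite root5_ge1.
have u4 : 1 <= (root5 k.+1 : R) ^+ 4 by rewrite exprn_ege1.
rewrite step_alphaE; move: (root5 k.+1 ^+ 4) u4 => t t1.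
have t0 : 0 < 9 * t by lra.
by rewrite divr_ge0 ?(ltW t0)//= ler_pdivrMr//; lra.
Qed.

(** The past determines [x k], [g k] and therefore [x k.+1], while the sample
    [B k.+1] is independent of it. *)
Lemma momentum_step k : (1 <= k)%N ->
  L1 P (fun w => enorm (err k w) ^+ 2) ->
  L1 P (fun w => enorm (err k.+1 w) ^+ 2) /\
  mean P (fun w => enorm (err k.+1 w) ^+ 2) <=
    (1 - al k.+1) ^+ 2 * mean P (fun w => enorm (err k w) ^+ 2) + noise k +
    4 * Lt ^+ 2 * rk k ^+ 2 * mean P (fun w => enorm (step k w) ^+ 2).
Proof.
move=> k1 Le; have Ls := L1_step k1 Le.
pose T := (@borel_rV R d * @borel_rV R d * S3)%type.
(* the next iterate as a function of the past *)
pose nx (p : 'rV[R]_d * 'rV[R]_d) := proj X (p.1 - eta k *: p.2).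
pose F (s : T) := tG (rk k.+1) (nx s.1) s.2 +
  (1 - al k.+1) *: (s.1.2 - tG (rk k) s.1.1 s.2) - GQ (rk k.+1) (nx s.1).
pose h (s : T) := enorm (F s) ^+ 2.
have mxT j : measurable_fun [set: T] (fun s => s.1.1 0 j).
  exact: (measurableT_comp (measurable_coord j) (measurableT_comp measurable_fst
    measurable_fst)).
have mgT j : measurable_fun [set: T] (fun s => s.1.2 0 j).
  exact: (measurableT_comp (measurable_coord j) (measurableT_comp measurable_snd
    measurable_fst)).
have mnx : measurable_fun [set: T] ((fun s => nx s.1) : T -> borel_rV d).
  apply: measurable_rV => j.
  have mp := continuous_borel_measurable
    (continuous_proj_coord closedX convexX x1X (j := j)).
  have mz : measurable_fun [set: T]
      ((fun s => s.1.1 - eta k *: s.1.2) : T -> borel_rV d).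
    apply: measurable_rV => i; under eq_fun do rewrite rV_coordB rV_coordZ.
    by apply: measurable_funB => //; exact: measurable_funM.
  exact: (measurableT_comp mp mz).
have mB : measurable_fun [set: T] (fun s : T => s.2) by exact: measurable_snd.
have mh : measurable_fun [set: T] h.
  apply: measurable_sqr_enorm => j; rewrite /F.
  under eq_fun do rewrite rV_coordB rV_coordD rV_coordZ rV_coordB.
  have mG := continuous_borel_measurable
    (continuous_grad_penalty (j := j) (rk_ge1 (ltn0Sn k))).
  apply: measurable_funB; last exact: (measurableT_comp mG mnx).
  apply: measurable_funD.
    by apply: measurable_penalty_grad => //; exact/measurable_rVP.
  apply: measurable_funM => //; apply: measurable_funB => //.
  exact: measurable_penalty_grad.
have nxE w : nx (past k w) = x k.+1 w by rewrite /nx/= -xS.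
pose u w := (1 - al k.+1) ^+ 2 * enorm (err k w) ^+ 2 + noise k +
   4 * Lt ^+ 2 * rk k ^+ 2 * enorm (step k w) ^+ 2.
have Lu1 := L1Z ((1 - al k.+1) ^+ 2) Le.
have Lu2 := L1Z (4 * Lt ^+ 2 * rk k ^+ 2) Ls.
have Lu3 := L1D Lu1 (L1_cst P (noise k)).
have Lu : L1 P u by exact: L1D.
have hu w : (\int[P]_w' (h (past k w, B k.+1 w'))%:E <= (u w)%:E)%E.
  have /andP[a0 a1] := alpha_le1 k.
  have [L M] := momentum_inner (x k w) (x k.+1 w) (g k w) (BS (ltn0Sn k))
    (rk_ge1 k1) (rk_ge1 (ltn0Sn k)) a0 a1.
  rewrite /h /F /= nxE (mean_EFin L) lee_fin.
  exact: M.
have [Lh Mh] := mean_freeze_le (measurable_past k1) (measurable_B (ltn0Sn k))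
  (past_indep k1) mh (fun s => sqr_ge0 _) Lu hu.
have hE : (fun w => h (past k w, B k.+1 w)) = (fun w => enorm (err k.+1 w) ^+
  2).
  by apply/funext => w; rewrite /h /F /= nxE /err gS.
apply: (eq_ind _ (fun z => L1 P z /\ mean P z <= _) _ _ hE).
split; first exact: Lh.
apply: (le_trans Mh); clear Mh Lh hE hu mh.
by rewrite /u (meanD Lu3 Lu2) (meanD Lu1 (L1_cst P _)) (meanZ _ Le) (meanZ _ Ls)
  mean_cst.
Qed.

(** Finiteness of the second moments propagates along the run. *)
Lemma L1_err k : (1 <= k)%N -> L1 P (fun w => enorm (err k w) ^+ 2).
Proof.
elim: k => // -[_ _|k ih _]; last by have [] := momentum_step (ltn0Sn k) (ih
  isT).
have [L _] := penalty_grad_var (BS (leqnn 1)) (rk 1) x1.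
have E : err 1 = fun w => tG (rk 1) x1 (B 1 w) - GQ (rk 1) x1.
  by apply/funext => w; rewrite /err; have [-> -> _] := run w;
    have [-> _ _] := run w.
by rewrite E.
Qed.

(** The step [x k.+1] leaves the normal vector [(x k - x k.+1) / eta - g] at
    [x k.+1], so this norm bounds the distance of the penalty gradient at
    [x k.+1] to the negative normal cone. *)
Definition resid k w := enorm (GQ (rk k) (x k.+1 w) +
  ((eta k)^-1 *: (x k w - x k.+1 w) - g k w)).

Lemma resid_ge0 k w : 0 <= resid k w.
Proof. exact: enorm_ge0. Qed.

Lemma resid_normal k w : (1 <= k)%N ->
  normal_cone X (x k.+1 w) ((eta k)^-1 *: (x k w - x k.+1 w) - g k w).
Proof.
move=> k1; rewrite xS//.
exact: (proj_step_normal closedX convexX x1X _ _ (eta_gt0 k)).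
Qed.

Lemma measurable_resid k : (1 <= k)%N -> measurable_fun [set: Om] (resid k).
Proof.
move=> k1; have mG := fun j => continuous_borel_measurable
  (continuous_grad_penalty (j := j) (rk_ge1 k1)).
have mx : measurable_fun [set: Om] (x k.+1 : Om -> borel_rV d).
  by apply: measurable_rV => i; exact: measurable_x.
have mF : measurable_fun [set: Om] ((fun w => GQ (rk k) (x k.+1 w) +
    ((eta k)^-1 *: (x k w - x k.+1 w) - g k w)) : Om -> borel_rV d).
  apply: measurable_rV => j.
  under eq_fun do rewrite rV_coordD rV_coordB rV_coordZ rV_coordB.
  apply: measurable_funD; first exact: (measurableT_comp (mG j) mx).
  apply: measurable_funB; last exact: measurable_g.
  by apply: measurable_funM => //; apply: measurable_funB; exact: measurable_x.
exact: (measurableT_comp (continuous_borel_measurable (@continuous_enorm R d))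
  mF).
Qed.

Lemma schedule_ge1 k : (1 <= k)%N ->
  [/\ 1 <= root5 k :> R, 1 <= root5 k.+1 :> R &
      root5 k.+1 ^+ 5 = root5 k ^+ 5 + 1 :> R].
Proof. by move=> k1; rewrite !root5_ge1// !root5K -natr1. Qed.

Lemma smoothness_le k : (1 <= k)%N -> Lt * rk k <= 1 / 9 / eta k.
Proof.
move=> k1; have [u1 v1 uv] := schedule_ge1 k1.
by rewrite step_etaE step_rhoE; apply: smoothness_step => //; exact: tildeL_gt0.
Qed.

Lemma resid_le k w : (1 <= k)%N ->
  resid k w <= 10 / 9 * ((eta k)^-1 * enorm (step k w)) + enorm (err k w).
Proof.
move=> k1; have e0 := eta_gt0 k.
have -> : resid k w = enorm ((GQ (rk k) (x k.+1 w) - GQ (rk k) (x k w)) -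
    (eta k)^-1 *: step k w - err k w).
  rewrite /resid /step /err; move: (GQ _ _) (GQ _ _) (eta k)^-1 => p1 p2 t.
  by congr enorm; apply/rowP => j; rewrite !mxE; ring.
rewrite (le_trans (enormB _ _))// lerD2r (le_trans (enormB _ _))//.
rewrite enormZ ger0_norm ?invr_ge0 ?(ltW e0)//.
have h := grad_penalty_lip (BS (leqnn 1)) (x k.+1 w) (x k w) (rk_ge1 k1).
have s := smoothness_le k1; have n0 := enorm_ge0 (step k w).
have := ler_wpM2r n0 s; rewrite {1}/step => s'.
move: (le_trans h s') => h'.
have -> : 10 / 9 * ((eta k)^-1 * enorm (step k w)) =
  1 / 9 / eta k * enorm (step k w) + (eta k)^-1 * enorm (step k w).
  by field; rewrite gt_eqF.
by rewrite lerD2r.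
Qed.

Lemma sqr_resid_le k w : (1 <= k)%N ->
  eta k * resid k w ^+ 2 <=
    200 / 81 * ((eta k)^-1 * enorm (step k w) ^+ 2) + 2 * eta k * enorm (err k
      w) ^+ 2.
Proof.
move=> k1; have e0 := eta_gt0 k; have h := resid_le w k1;
  have r0 := resid_ge0 k w.
set p := (eta k)^-1 * enorm (step k w) in h; set q := enorm (err k w) in h *.
have h2 : resid k w ^+ 2 <= 200 / 81 * p ^+ 2 + 2 * q ^+ 2.
  have : resid k w ^+ 2 <= (10 / 9 * p + q) ^+ 2.
    by rewrite ler_sqr ?nnegrE// (le_trans r0).
  have := sqr_ge0 (10 / 9 * p - q); rewrite !expr2; lra.
have := ler_wpM2l (ltW e0) h2; rewrite mulrDr.
have -> : eta k * (200 / 81 * p ^+ 2) =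
    200 / 81 * ((eta k)^-1 * enorm (step k w) ^+ 2).
  by rewrite /p; field; rewrite gt_eqF.
by have -> : eta k * (2 * q ^+ 2) = 2 * eta k * q ^+ 2 by ring.
Qed.

Lemma dist_resid k w : (1 <= k)%N ->
  dist (grad f (x k.+1 w) + (rk k *: c (x k.+1 w)) *m jac c (x k.+1 w))
    (neg_set (normal_cone X (x k.+1 w))) <= resid k w.
Proof.
move=> k1; have := dist_neg_normal_le (GQ (rk k) (x k.+1 w)) (resid_normal w
  k1).
by rewrite /resid /grad_penalty -scalemxAl.
Qed.

(** By the regularity condition and since the normal cone is a cone, the
    constraint part of the penalty gradient cannot be cancelled by normal
    directions; what is left of it is at most [grad f] and the residual. *)
Lemma feasibility_resid k : (1 <= k)%N -> {ae P, forall w,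
  delta * rk k * enorm (c (x k.+1 w)) <= Cgf + resid k w}.
Proof.
move=> k1; have rk0 : 0 < rk k := lt_le_trans ltr01 (rk_ge1 k1).
apply: filterS (regularity (ltn0Sn k)) => w reg.
have Nv := normal_coneZ (ltW (etrans (invr_gt0 _) rk0)) (resid_normal w k1).
have := le_trans reg (dist_neg_normal_le _ Nv).
set v := _ - g k w; set cJ := c _ *m _ => h.
rewrite [delta * _]mulrC -mulrA.
apply: (le_trans (ler_wpM2l (ltW rk0) h)).
rewrite -{1}(ger0_norm (ltW rk0)) -enormZ scalerDr scalerA divff ?gt_eqF//
  scale1r.
have -> : rk k *: cJ + v = (GQ (rk k) (x k.+1 w) + v) - grad f (x k.+1 w).
  rewrite /grad_penalty -/cJ.
  by move: (grad f _) (rk k *: cJ) (v) => p1 p2 p3;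
    rewrite -[p1 + p2 + p3]addrA [RHS]addrC addKr.
by rewrite (le_trans (enormB _ _))// addrC lerD2r.
Qed.

(** The cost of increasing the penalty parameter at iteration [k] is
    [drift_const / k]. *)
Definition drift_const : R :=
  Cc * Cgf / delta + 3 * Cc ^+ 2 * Lt * rho / delta ^+ 2.

(** Young's inequality for [e * n] leaves half of [n^2 / t], of which the
    smoothness term takes [1/9]: [1 - 1/2 - 1/9 = 7/18]. *)
Lemma decrease_bound (q q' gs es n e t L : R) : 0 < t -> 0 <= n ->
  q' <= q + (gs - es) + L * n ^+ 2 -> gs <= - (t^-1 * n ^+ 2) ->
  - es <= e * n -> L <= 1 / 9 / t ->
  q' + 7 / 18 * (t^-1 * n ^+ 2) <= q + t / 2 * e ^+ 2.
Proof.
move=> t0 n0 h1 h2 h3 h4.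
have h5 := ler_wpM2r (sqr_ge0 n) h4.
have young : e * n <= t / 2 * e ^+ 2 + t^-1 * n ^+ 2 / 2.
  rewrite -subr_ge0.
  have -> : t / 2 * e ^+ 2 + t^-1 * n ^+ 2 / 2 - e * n = t / 2 * (e - n / t) ^+
    2.
    by field; rewrite gt_eqF.
  by rewrite mulr_ge0 ?sqr_ge0// divr_ge0 ?(ltW t0).
move: h1 h2 h3 h5 young; rewrite -(mulrA (1 / 9)).
by move: (t^-1 * n ^+ 2) (L * n ^+ 2) (e * n) (t / 2 * e ^+ 2) => *; lra.
Qed.

(** The inner product [<GQ, step>] equals [<g, step> - <err, step>]; the first
    term is at most [- |step|^2 / eta] by the projection inequality. *)
Lemma penalty_decrease k w : (1 <= k)%N ->
  penalty f c (rk k) (x k.+1 w) + 7 / 18 * ((eta k)^-1 * enorm (step k w) ^+ 2)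
  <= penalty f c (rk k) (x k w) + eta k / 2 * enorm (err k w) ^+ 2.
Proof.
move=> k1; have e0 := eta_gt0 k.
have r1 := rk_ge1 k1.
have LtP := tildeL_gt0.
have Lr0 : 0 <= Lt * rk k by rewrite mulr_ge0 ?(ltW LtP)// (le_trans ler01).
have D := penalty_descent f_diff c_diff (x k w) (x k.+1 w) Lr0
  (fun u v => grad_penalty_lip (BS (leqnn 1)) u v r1).
have [_ /(_ _ (x_mem w k1)) nv] := resid_normal w k1.
rewrite -/(step k w) in D.
have gstep : dotv (g k w) (step k w) <= - ((eta k)^-1 * enorm (step k w) ^+ 2).
  move: nv; have -> : x k w - x k.+1 w = - step k w by rewrite opprB.
  rewrite dotvBl dotvZl !dotvNr dotvNl !opprK -sqr_enorm => h.
  by rewrite -subr_le0 opprK addrC.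
have gerr : GQ (rk k) (x k w) = g k w - err k w
  by rewrite /err opprB addrC subrK.
rewrite gerr dotvBl in D.
have CS : - dotv (err k w) (step k w) <= enorm (err k w) * enorm (step k w).
  by rewrite -dotvNl (le_trans (dotv_le_enorm _ _))// enormN.
exact: (decrease_bound e0 (enorm_ge0 _) D gstep CS (smoothness_le k1)).
Qed.

(** * The potential *)

(** One descent step followed by the increase [s] of the penalty parameter, up to
    the share [t * b / 64] of the squared residual;
      [7/18 - 200/(81 * 64) >= 1/3]
    and [1/2 + 2/64 = 17/32]. *)
Lemma increment_bound (q q1 q' l n e s t b C : R) :
  q1 + 7 / 18 * n <= q + t / 2 * e -> q' = q1 + s ->
  s <= t * b / 64 + C -> t * b <= 200 / 81 * n + 2 * t * e -> 0 <= n ->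
  q' - l + 1 / 3 * n <= q - l + 17 / 32 * (t * e) + C.
Proof.
by rewrite (mulrAC t) -!(mulrA 2); move: (t * e) (t * b) => *; lra.
Qed.

Lemma penalty_diff r r' y : penalty f c r' y =
  penalty f c r y + (r' - r) / 2 * enorm (c y) ^+ 2.
Proof. by rewrite /penalty sqr_enorm_sum; field. Qed.

Definition gap k w := penalty f c (rk k) (x k w) - Qlow.

Lemma gap_ge0 k w : (1 <= k)%N -> 0 <= gap k w.
Proof. by move=> k1; rewrite subr_ge0 Q_bound// (lt_le_trans ltr01 (rk_ge1 k1)).
  Qed.

Lemma continuous_c_coord i : continuous (fun y => c y 0 i).
Proof.
move=> y; apply: (@continuous_comp _ _ _ c (fun z : 'rV[R]_m => z 0 i)).
  exact: differentiable_continuous.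
exact: coord_continuous.
Qed.

Lemma measurable_xk k : (1 <= k)%N -> measurable_fun [set: Om] (x k : Om ->
  borel_rV d).
Proof. by move=> k1; apply: measurable_rV => i; exact: measurable_x. Qed.

Lemma measurable_c k i : (1 <= k)%N -> measurable_fun [set: Om] (fun w => c (x k
  w) 0 i).
Proof.
move=> k1; have mc := continuous_borel_measurable (@continuous_c_coord i).
exact: (measurableT_comp mc (measurable_xk k1)).
Qed.

Lemma L1_gap k : (1 <= k)%N -> L1 P (gap k).
Proof.
move=> k1; have rk0 : 0 <= rk k := le_trans ler01 (rk_ge1 k1).
have mf : measurable_fun [set: Om] (fun w => f (x k w)).
  have cf : continuous f by move=> y; exact: differentiable_continuous.
  exact: (measurableT_comp (continuous_borel_measurable cf) (measurable_xk k1)).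
have mn : measurable_fun [set: Om] (fun w => enorm (c (x k w)) ^+ 2).
  by apply: measurable_sqr_enorm => j; exact: measurable_c.
have Lf : L1 P (fun w => f (x k w)) := L1_bounded mf (f_bound k1).
have Ln : L1 P (fun w => enorm (c (x k w)) ^+ 2).
  apply: (@L1_bounded _ _ _ _ _ (Cc ^+ 2) mn); apply/aeW => w.
  by rewrite ger0_norm ?sqr_ge0// ler_sqr ?nnegrE ?enorm_ge0// ltW.
have := L1B (L1D Lf (L1Z (rk k / 2) Ln)) (L1_cst P Qlow).
congr L1; apply/funext => w.
by rewrite /gap /penalty sqr_enorm_sum.
Qed.

Lemma gap_step k : (1 <= k)%N -> {ae P, forall w,
  gap k.+1 w + 1 / 3 * ((eta k)^-1 * enorm (step k w) ^+ 2) <=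
  gap k w + 17 / 32 * (eta k * enorm (err k w) ^+ 2) + drift_const / k%:R}.
Proof.
move=> k1; apply: filterS (feasibility_resid k1) => w feas.
have [u1 v1 uv] := schedule_ge1 k1.
have D := penalty_decrease w k1.
have S := sqr_resid_le w k1.
have E := penalty_diff (rk k) (rk k.+1) (x k.+1 w).
have G := penalty_growth tildeL_gt0 rho_gt1 u1 v1 uv delta_gt0
  (enorm_ge0 (c (x k.+1 w))) (c_bound _) (ltW Cgf_gt0) (resid_ge0 k w) feas.
rewrite -step_etaE root5K -/drift_const in G.
have n0 : 0 <= (eta k)^-1 * enorm (step k w) ^+ 2.
  by rewrite mulr_ge0 ?sqr_ge0// invr_ge0 ltW// eta_gt0.
exact: increment_bound D E G S n0.
Qed.

Definition mean_gap k := mean P (gap k).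
Definition mean_err k := mean P (fun w => enorm (err k w) ^+ 2).
Definition mean_step k := mean P (fun w => enorm (step k w) ^+ 2).

Lemma mean_gap_step k : (1 <= k)%N ->
  mean_gap k.+1 + 1 / 3 * ((eta k)^-1 * mean_step k) <=
  mean_gap k + 17 / 32 * (eta k * mean_err k) + drift_const / k%:R.
Proof.
move=> k1; have Le := L1_err k1; have Ls := L1_step k1 Le.
have Lg := L1_gap k1; have Lg' := L1_gap (ltn0Sn k).
have Ls' := L1Z (1 / 3) (L1Z (eta k)^-1 Ls).
have Le' := L1Z (17 / 32) (L1Z (eta k) Le).
have Lc := L1_cst P (drift_const / k%:R).
have := mean_le (L1D Lg' Ls') (L1D (L1D Lg Le') Lc) (gap_step k1).
rewrite (meanD Lg' Ls') (meanD (L1D Lg Le') Lc) (meanD Lg Le') mean_cst.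
by rewrite (meanZ _ (L1Z _ Ls)) (meanZ _ Ls) (meanZ _ (L1Z _ Le)) (meanZ _ Le).
Qed.

(** Large enough for the contraction of the error to pay for its cost in the
    descent, small enough for the descent to pay for the step. *)
Definition weight k : R := root5 k / (2 * Lt * rho).
Definition potential k := mean_gap k + weight k * mean_err k.

Definition noise_const : R :=
  (2 * sf ^+ 2 + 4 * rho ^+ 2 * ((tCc * tCgc) ^+ 2 + (Cc * Cgc) ^+ 2)) / (Lt *
    rho)
  + rho * (tCc * tCgc) ^+ 2 / Lt.

(** Of the [1/3] paid by descent for the step, [2/9] goes to the momentum
    recursion; of the full [t * a] gained by contraction, [17/32] goes to descent. *)
Lemma potential_bound (q q' a a' th th' t D n C1 C2 b e : R) :
  q' + 1 / 3 * (t^-1 * D) <= q + 17 / 32 * (t * a) + C1 ->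
  a' <= b * a + n + e * D -> th' * b <= th - t -> th' * e <= 2 / 9 / t ->
  th' * n <= C2 -> 0 <= th' -> 0 <= a -> 0 <= D ->
  q' + th' * a' + 1 / 9 * (t^-1 * D) + 15 / 32 * (t * a) <= q + th * a + (C1 +
    C2).
Proof.
move=> h1 h2 h3 h4 h5 th0 a0 D0.
have k2 := ler_wpM2l th0 h2; have k3 := ler_wpM2r a0 h3;
  have k4 := ler_wpM2r D0 h4.
rewrite !mulrDr !(mulrA th') in k2; rewrite mulrBl in k3;
  rewrite -(mulrA (2 / 9)) in k4.
move: h1 k2 k3 k4 h5.
move: (t^-1 * D) (t * a) (th' * a') (th' * b * a) (th' * e * D) (th' * n) (th *
  a).
by move=> *; lra.
Qed.

Lemma mean_err_ge0 k : 0 <= mean_err k.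
Proof. by apply: mean_ge0 => w; exact: sqr_ge0. Qed.

Lemma mean_step_ge0 k : 0 <= mean_step k.
Proof. by apply: mean_ge0 => w; exact: sqr_ge0. Qed.

Lemma weight_ge0 k : 0 <= weight k.
Proof.
have L0 := tildeL_gt0.
by rewrite divr_ge0 ?root5_ge0// mulr_ge0 ?(ltW rho_gt0)// mulr_ge0// ltW.
Qed.

Lemma potential_step k : (1 <= k)%N ->
  potential k.+1 + 1 / 9 * ((eta k)^-1 * mean_step k) + 15 / 32 * (eta k *
    mean_err k)
  <= potential k + (drift_const + noise_const) / k%:R.
Proof.
move=> k1; have [u1 v1 uv] := schedule_ge1 k1.
have [_ M] := momentum_step k1 (L1_err k1).
have G := mean_gap_step k1.
have W1 := weight_contraction tildeL_gt0 rho_gt1 u1 v1 uv.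
have W2 := weight_step tildeL_gt0 rho_gt1 u1 v1 uv.
have W3 := weight_noise (tCc * tCgc) tildeL_gt0 rho_gt1 u1 v1 uv (sqr_ge0 sf)
  (addr_ge0 (sqr_ge0 (tCc * tCgc)) (sqr_ge0 (Cc * Cgc))).
rewrite -step_etaE -step_alphaE in W1; rewrite -step_etaE in W2.
rewrite -step_alphaE root5K -/noise_const in W3.
rewrite [_ / k%:R]mulrDl.
exact: (potential_bound G M W1 W2 W3 (weight_ge0 k.+1) (mean_err_ge0 k)
  (mean_step_ge0 k)).
Qed.

Lemma potential_ge0 k : (1 <= k)%N -> 0 <= potential k.
Proof.
move=> k1; apply: addr_ge0; first by apply: mean_ge0 => w; exact: gap_ge0.
by rewrite mulr_ge0 ?weight_ge0 ?mean_err_ge0.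
Qed.

Lemma L1_sqr_resid k : (1 <= k)%N -> L1 P (fun w => resid k w ^+ 2) /\
  eta k * mean P (fun w => resid k w ^+ 2) <=
    200 / 81 * ((eta k)^-1 * mean_step k) + 2 * eta k * mean_err k.
Proof.
move=> k1; have Le := L1_err k1; have Ls := L1_step k1 Le; have e0 := eta_gt0 k.
have Ls' := L1Z (200 / 81) (L1Z (eta k)^-1 Ls).
have Le' := L1Z (2 * eta k) Le.
have LH := L1D Ls' Le'.
have mr : measurable_fun [set: Om] (fun w => resid k w ^+ 2).
  by apply: measurable_funX; exact: measurable_resid.
have Lr : L1 P (fun w => resid k w ^+ 2).
  apply: (L1_le mr (L1Z (eta k)^-1 LH)); apply/aeW => w.
  rewrite ger0_norm ?sqr_ge0// -ler_pdivrMl ?invr_gt0// invrK.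
  exact: sqr_resid_le.
split => //; rewrite -(meanZ _ Lr).
have := mean_le (L1Z (eta k) Lr) LH (aeW P (fun w => sqr_resid_le w k1)).
by rewrite (meanD Ls' Le') (meanZ _ (L1Z _ Ls)) (meanZ _ Ls) (meanZ _ Le).
Qed.

(** Since [200/81 <= 23/9]. *)
Lemma absorb_bound (r p q : R) : 0 <= p -> 0 <= q ->
  r <= 200 / 81 * p + 2 * q -> r <= 23 * (1 / 9 * p + 15 / 32 * q).
Proof. by move=> *; lra. Qed.

Lemma telescope_bound (S r F0 F1 p q i C H K : R) :
  S + 23 * F1 <= 23 * (i + C * H) -> r <= 23 * (1 / 9 * p + 15 / 32 * q) ->
  F0 + 1 / 9 * p + 15 / 32 * q <= F1 + C / K ->
  S + r + 23 * F0 <= 23 * (i + C * (H + K^-1)).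
Proof. by rewrite (mulrDr C); move: (C * H) (C / K) => *; lra. Qed.

(** Telescoping the potential: the sum of the weighted squared residuals grows
    only like the harmonic sum. *)
Lemma sum_sqr_resid K :
  \sum_(k < K) eta k.+1 * mean P (fun w => resid k.+1 w ^+ 2) <=
  23 * (potential 1 + (drift_const + noise_const) * \sum_(k < K) k.+1%:R^-1).
Proof.
suff H : \sum_(k < K) eta k.+1 * mean P (fun w => resid k.+1 w ^+ 2) +
    23 * potential K.+1 <=
  23 * (potential 1 + (drift_const + noise_const) * \sum_(k < K) k.+1%:R^-1).
  by rewrite (le_trans _ H)// lerDl mulr_ge0// potential_ge0.
elim: K => [|K ih]; first by rewrite !big_ord0 mulr0 addr0 add0r.
rewrite !big_ord_recr/=.
have [_ r2] := L1_sqr_resid (ltn0Sn K).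
have e0 := eta_gt0 K.+1.
have p0 : 0 <= (eta K.+1)^-1 * mean_step K.+1.
  by rewrite mulr_ge0 ?mean_step_ge0// invr_ge0 ltW.
have q0 : 0 <= eta K.+1 * mean_err K.+1.
  by rewrite mulr_ge0 ?mean_err_ge0// ltW.
rewrite -(mulrA 2) in r2.
have ab := absorb_bound p0 q0 r2.
have ps := potential_step (ltn0Sn K).
set rr := eta K.+1 * _ in ab *; set SS := \sum_(_ < K) _ in ih *.
set HH := \sum_(_ < K) _ in ih *.
exact: (telescope_bound ih ab ps).
Qed.

(** * Averaging over the iterations *)

Definition budget_const : R :=
  1 / 2 + 184 * Lt * rho * (potential 1 + (drift_const + noise_const)).

Lemma noise_consts_ge0 : 0 <= drift_const + noise_const.
Proof.
have L0 := tildeL_gt0; rewrite /drift_const /noise_const.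
by do ?[exact: ltW|exact: sqr_ge0|apply: addr_ge0|apply: divr_ge0|apply:
  mulr_ge0].
Qed.

Lemma L1_resid k : (1 <= k)%N -> L1 P (resid k).
Proof.
move=> k1; have [L _] := L1_sqr_resid k1.
apply: (L1_le (measurable_resid k1) (L1D L (L1_cst P 1))); apply/aeW => w.
rewrite ger0_norm ?resid_ge0//.
have := sqr_ge0 (resid k w - 1); rewrite sqrrB1.
by move: (resid k w) (resid_ge0 k w) => r r0; rewrite -mulr_natl; lra.
Qed.

Lemma mean_resid_le k (s : R) : (1 <= k)%N -> 0 < s ->
  mean P (resid k) <= s / 2 + (2 * s)^-1 * mean P (fun w => resid k w ^+ 2).
Proof.
move=> k1 s0; have [L _] := L1_sqr_resid k1; have L' := L1Z (2 * s)^-1 L.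
have Lc := L1_cst P (s / 2).
rewrite -(meanZ _ L) -[X in X + _](mean_cst P) -(meanD Lc L').
apply: (mean_le (L1_resid k1) (L1D Lc L')); apply/aeW => w.
rewrite -subr_ge0.
have -> : s / 2 + (2 * s)^-1 * resid k w ^+ 2 - resid k w =
    (2 * s)^-1 * (resid k w - s) ^+ 2 by field; rewrite gt_eqF.
by rewrite mulr_ge0 ?sqr_ge0// invr_ge0 mulr_ge0// ltW.
Qed.

(** Cauchy-Schwarz in the form [r <= s/2 + r^2/(2s)] with [s = K^(-1/5)]; the
    weights [eta k] are bounded below by [eta K], of order [K^(-3/5)]. *)
Lemma avg_resid K : (0 < K)%N ->
  \sum_(k < K) mean P (resid k.+1) <=
  K%:R * (budget_const * (1 + harmonic_sum K) / root5 K).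
Proof.
move=> K0; have u0 : 0 < root5 K :> R by rewrite (lt_le_trans ltr01)//
  root5_ge1.
pose u : R := root5 K; have LtP := tildeL_gt0.
pose S2 := \sum_(k < K) mean P (fun w => resid k.+1 w ^+ 2).
have le1 : \sum_(k < K) mean P (resid k.+1) <= K%:R * (u^-1 / 2) + (2 * u^-1)^-1
  * S2.
  rewrite /S2 mulr_sumr -[X in X%:R * _]card_ord -sum1_card natr_sum mulr_suml.
  rewrite -big_split/=; apply: ler_sum => k _; rewrite mul1r.
  by apply: mean_resid_le => //; rewrite invr_gt0.
have eK : 0 < eta K := eta_gt0 K.
have S2le : eta K * S2 <=
    23 * (potential 1 + (drift_const + noise_const) * harmonic_sum K).
  apply: le_trans (sum_sqr_resid K); rewrite mulr_sumr; apply: ler_sum => k _.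
  rewrite ler_wpM2r//; first by apply: mean_ge0 => w; exact: sqr_ge0.
  exact: step_eta_mono.
have S20 : 0 <= S2.
  by apply: sumr_ge0 => k _; apply: mean_ge0 => w; exact: sqr_ge0.
have inv := step_eta_inv_le LtP rho_gt0 K0.
apply: (le_trans le1).
exact: (average_bound u0 (root5K K) eK inv S2le S20 (potential_ge0 (leqnn 1))
  noise_consts_ge0 (harmonic_sum_ge0 K)).
Qed.

Definition feas_const : R := (Cgf + budget_const) / (delta * rho).

Lemma L1_feas k : (1 <= k)%N -> L1 P (fun w => enorm (c (x k w))).
Proof.
move=> k1; have mc : measurable_fun [set: Om] (fun w => enorm (c (x k w))).
  have mcx : measurable_fun [set: Om] ((fun w => c (x k w)) : Om -> borel_rV m).
    by apply: measurable_rV => j; exact: measurable_c.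
  exact: (measurableT_comp (continuous_borel_measurable (@continuous_enorm R m))
    mcx).
apply: (@L1_bounded _ _ _ _ _ Cc mc); apply/aeW => w.
by rewrite ger0_norm ?enorm_ge0.
Qed.

Lemma mean_feas_le k : (1 <= k)%N -> mean P (fun w => enorm (c (x k.+1 w))) <=
  (Cgf * (root5 k)^-1 + mean P (resid k)) / (delta * rho).
Proof.
move=> k1; have u1 : 1 <= root5 k :> R := root5_ge1 k1.
have u0 : 0 < root5 k :> R by rewrite (lt_le_trans ltr01).
have dr0 : 0 < delta * rho by rewrite mulr_gt0.
have Lr := L1_resid k1; have Lc := L1_cst P (Cgf * (root5 k)^-1).
have LH := L1Z (delta * rho)^-1 (L1D Lc Lr).
rewrite mulrC -[X in X + _](mean_cst P) -(meanD Lc Lr) -(meanZ _ (L1D Lc Lr)).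
apply: (mean_le (L1_feas (ltn0Sn k)) LH).
apply: filterS (feasibility_resid k1) => w; rewrite step_rhoE => h.
exact: (feas_bound dr0 u1 (resid_ge0 k w) h).
Qed.

Lemma avg_feas K : (0 < K)%N ->
  \sum_(k < K) mean P (fun w => enorm (c (x k.+2 w))) <=
  K%:R * (feas_const * (1 + harmonic_sum K) / root5 K).
Proof.
move=> K0; have dr0 : 0 < delta * rho by rewrite mulr_gt0.
apply: (@le_trans _ _ ((\sum_(k < K) (Cgf * (root5 k.+1)^-1 + mean P (resid
  k.+1)))
    / (delta * rho))).
  by rewrite mulr_suml; apply: ler_sum => k _; exact: mean_feas_le.
rewrite ler_pdivrMr// big_split/= -mulr_sumr.
apply: (le_trans (lerD (ler_wpM2l (ltW Cgf_gt0) (@sum_inv_root5_le R K K0))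
  (avg_resid K0))).
have u0 : root5 K != 0 :> R by rewrite gt_eqF// (lt_le_trans ltr01)// root5_ge1.
rewrite le_eqVlt; apply/orP; left; apply/eqP; rewrite /feas_const.
by field; rewrite u0 !gt_eqF.
Qed.

Definition multiplier (z : Om * nat) : 'rV[R]_m := rk z.2 *: c (x z.2.+1 z.1).

Lemma measurable_multiplier i :
  measurable_fun [set: Om * nat] (fun z => multiplier z 0 i).
Proof.
apply: measurable_prod_nat => k; rewrite /multiplier/=.
under eq_fun do rewrite rV_coordZ.
by apply: measurable_funM => //; exact: measurable_c.
Qed.

Lemma budget_const_gt0 : 0 < budget_const.
Proof.
have L0 := tildeL_gt0; rewrite /budget_const.
apply: ltr_pwDl => //; apply: mulr_ge0.
  by apply: mulr_ge0; [apply: mulr_ge0 => //; exact: ltW|exact: ltW].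
by apply: addr_ge0; [exact: potential_ge0|exact: noise_consts_ge0].
Qed.

Lemma complexity : exists C p : R, 0 < C /\ 0 < p /\
    forall eps : R, 0 < eps -> eps <= 1 / 2 ->
    exists K : nat, (0 < K)%N /\
      K%:R <= C * eps ^- 5 * ln (1 / eps) `^ p /\
      exists lambda : Om * nat -> 'rV[R]_m,
        (forall i, measurable_fun [set: Om * nat] (fun w => lambda w 0 i)) /\
        ('E_(P \x unif1 K)[(fun w : Om * nat =>
            dist (grad f (x w.2.+1 w.1) + lambda w *m jac c (x w.2.+1 w.1))
                 (neg_set (normal_cone X (x w.2.+1 w.1))))%R] <= eps%:E)%E /\
        ('E_(P \x unif1 K)[(fun w : Om * nat => enorm (c (x w.2.+1 w.1)))%R]
            <= eps%:E)%E.
Proof.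
have b0 := budget_const_gt0.
have f0 : 0 < feas_const.
  by apply: divr_gt0; [exact: addr_gt0|exact: mulr_gt0].
pose A := budget_const + feas_const; have A0 : 0 < A by exact: addr_gt0.
have [C C0 HC] := choose_budget A0.
exists C, 5; split => //; split => // eps e0 e2.
have [K [K0 KC Ke]] := HC eps e0 e2.
exists K; split => //; split => //; exists multiplier; split.
  exact: measurable_multiplier.
have u0 : 0 < root5 K :> R by rewrite (lt_le_trans ltr01)// root5_ge1.
have K0' : 0 < K%:R :> R by rewrite ltr0n.
have bound (a s : R) : 0 <= a -> a <= A ->
    s <= K%:R * (a * (1 + harmonic_sum K) / root5 K) -> K%:R^-1 * s <= eps.
  move=> a0 aA h; rewrite ler_pdivrMl//; apply: (le_trans h).
  rewrite ler_pM2l//; apply: le_trans Ke.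
  rewrite ler_pM2r ?invr_gt0//.
  have H1 : 0 <= 1 + harmonic_sum K :> R by rewrite addr_ge0// harmonic_sum_ge0.
  apply: ler_pM => //.
  by have := @harmonic_sum_le R K K0; rewrite -[2]/(1 + 1) -addrA lerD2l.
split.
  apply: (@le_trans _ _ (K%:R^-1 * \sum_(k < K) mean P (resid k.+1))%:E).
    apply: (@expectation_unif1_le _ _ _ P K _ resid K0).
    + by move=> z; exact: dist_ge0.
    + exact: L1_resid.
    + by move=> k w k1; exact: dist_resid.
  by rewrite lee_fin; apply: bound (avg_resid K0);
    [exact: ltW|rewrite lerDl ltW].
apply: (@le_trans _ _ (K%:R^-1 *
    \sum_(k < K) mean P (fun w => enorm (c (x k.+2 w))))%:E).
  apply: (@expectation_unif1_le _ _ _ P K _ (fun k w => enorm (c (x k.+1 w)))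
    K0).
  + by move=> z; exact: enorm_ge0.
  + by move=> k k1; exact: L1_feas.
  + by [].
by rewrite lee_fin; apply: bound (avg_feas K0); [exact: ltW|rewrite lerDr ltW].
Qed.

End Run.

End Slqp.

Theorem theorem3p1 (R : realType) (d m : nat)
  (* problem data *)
  (X : set 'rV[R]_d) (closedX : closed X) (convexX : convex_set X)
  (f : 'rV[R]_d -> R) (c : 'rV[R]_d -> 'rV[R]_m)
  (f_diff : forall x, differentiable f x)
  (c_diff : forall x, differentiable c x)
  (f_smooth : lipschitz_map (grad f))
  (c_smooth : forall i : 'I_m, lipschitz_map (fun x => row i (jac c x)))
  (* stochastic oracles *)
  (dxi dzeta : measure_display)
  (Sxi : measurableType dxi) (Szeta : measurableType dzeta)
  (Pxi : probability Sxi R) (Pzeta : probability Szeta R)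
  (tf : 'rV[R]_d -> Sxi -> R) (tc : 'rV[R]_d -> Szeta -> 'rV[R]_m)
  (Gf : 'rV[R]_d -> Sxi -> 'rV[R]_d)
  (Gc : 'rV[R]_d -> Szeta -> 'M[R]_(m, d))
  (tc_meas : jointly_measurable_vec tc)
  (Gf_meas : jointly_measurable_vec Gf)
  (Gc_meas : jointly_measurable_mx Gc)
  (tf_mean : forall x, has_mean Pxi (tf x) (f x))
  (tc_mean : forall x i, has_mean Pzeta (fun z => tc x z 0 i) (c x 0 i))
  (Gf_mean : forall x j, has_mean Pxi (fun s => Gf x s 0 j) (grad f x 0 j))
  (Gc_mean : forall x i j, has_mean Pzeta (fun z => Gc x z i j) (jac c x i j))
  (* constants *)
  (tLf tLgc tLc sf sgc sc Cgc Cc tCgc tCc Cgf Bf Qlow delta : R)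
  (tLf_gt0 : 0 < tLf) (tLgc_gt0 : 0 < tLgc) (tLc_gt0 : 0 < tLc)
  (sf_gt0 : 0 < sf) (sgc_gt0 : 0 < sgc) (sc_gt0 : 0 < sc)
  (Cgc_gt0 : 0 < Cgc) (Cc_gt0 : 0 < Cc)
  (tCgc_gt0 : 0 < tCgc) (tCc_gt0 : 0 < tCc)
  (Cgf_gt0 : 0 < Cgf) (Bf_gt0 : 0 < Bf) (delta_gt0 : 0 < delta)
  (* (i) *)
  (Gf_lip : forall x y, ('E_Pxi[(fun s => enorm (Gf x s - Gf y s) ^+ 2)%R]
      <= (tLf ^+ 2 * enorm (x - y) ^+ 2)%:E)%E)
  (Gc_lip : forall x y, ('E_Pzeta[(fun z => opnorm (Gc x z - Gc y z) ^+ 2)%R]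
      <= (tLgc ^+ 2 * enorm (x - y) ^+ 2)%:E)%E)
  (tc_lip : forall x y, ('E_Pzeta[(fun z => enorm (tc x z - tc y z) ^+ 2)%R]
      <= (tLc ^+ 2 * enorm (x - y) ^+ 2)%:E)%E)
  (* (ii) *)
  (Gf_var : forall x, ('E_Pxi[(fun s => enorm (Gf x s - grad f x) ^+ 2)%R]
      <= (sf ^+ 2)%:E)%E)
  (Gc_var : forall x, ('E_Pzeta[(fun z => opnorm (Gc x z - jac c x) ^+ 2)%R]
      <= (sgc ^+ 2)%:E)%E)
  (tc_var : forall x, ('E_Pzeta[(fun z => enorm (tc x z - c x) ^+ 2)%R]
      <= (sc ^+ 2)%:E)%E)
  (* (iii), except for the bound along the iterates *)
  (jac_bound : forall x, opnorm (jac c x) <= Cgc)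
  (c_bound : forall x, enorm (c x) <= Cc)
  (Gc_bound : forall x, {ae Pzeta, forall z, opnorm (Gc x z) <= tCgc})
  (tc_bound : forall x, {ae Pzeta, forall z, enorm (tc x z) <= tCc})
  (gradf_bound : forall x, enorm (grad f x) <= Cgf)
  (Q_bound : forall r x, 0 < r -> Qlow <= penalty f c r x)
  (* samples: the triples (B k), k >= 1, are independent *)
  (dOm : measure_display) (Om : measurableType dOm) (P : probability Om R)
  (B : nat -> Om -> Sxi * Szeta * Szeta)
  (B_xi : forall k, (1 <= k)%N -> has_law P (fun w => (B k w).1.1) Pxi)
  (B_zeta1 : forall k, (1 <= k)%N -> has_law P (fun w => (B k w).1.2) Pzeta)
  (B_zeta2 : forall k, (1 <= k)%N -> has_law P (fun w => (B k w).2) Pzeta)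
  (B_zeta_indep : forall k, (1 <= k)%N ->
     indep2 P (fun w => (B k w).1.2) (fun w => (B k w).2))
  (B_indep : mutually_indep P (fun k => B k.+1))
  (* the run *)
  (rho : R) (rho_gt1 : 1 < rho)
  (x1 : 'rV[R]_d) (x1X : X x1)
  (x g : nat -> Om -> 'rV[R]_d)
  (run : forall w, slqp_run X Gf Gc tc
     (step_eta (tildeL m tLf tLgc tLc tCgc tCc) rho) (step_rho rho) step_alpha
     x1 (B ^~ w) (x ^~ w) (g ^~ w))
  (* rest of (iii), and (iv) *)
  (f_bound : forall k, (1 <= k)%N -> {ae P, forall w, `|f (x k w)| <= Bf})
  (regularity : forall k, (1 <= k)%N -> {ae P, forall w,
     delta * enorm (c (x k w)) <=
     dist (c (x k w) *m jac c (x k w)) (neg_set (normal_cone X (x k w)))}) :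
  exists C p : R, 0 < C /\ 0 < p /\
    forall eps : R, 0 < eps -> eps <= 1 / 2 ->
    exists K : nat, (0 < K)%N /\
      K%:R <= C * eps ^- 5 * ln (1 / eps) `^ p /\
      (* w = (run, khat) under the product of P and the uniform law *)
      exists lambda : Om * nat -> 'rV[R]_m,
        (forall i, measurable_fun [set: Om * nat] (fun w => lambda w 0 i)) /\
        ('E_(P \x unif1 K)[(fun w : Om * nat =>
            dist (grad f (x w.2.+1 w.1) + lambda w *m jac c (x w.2.+1 w.1))
                 (neg_set (normal_cone X (x w.2.+1 w.1))))%R] <= eps%:E)%E /\
        ('E_(P \x unif1 K)[(fun w : Om * nat => enorm (c (x w.2.+1 w.1)))%R]
            <= eps%:E)%E.
Proof.
have BS k (k1 : (1 <= k)%N) : is_sample Pxi Pzeta P (B k).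
  by split; [exact: B_xi|exact: B_zeta1|exact: B_zeta2|exact: B_zeta_indep].
exact: (complexity tc_meas Gf_meas Gc_meas tc_mean Gf_mean Gc_mean tLf_gt0
  tCgc_gt0 tCc_gt0 Cc_gt0 Gf_lip Gc_lip tc_lip Gf_var jac_bound c_bound
  Gc_bound tc_bound closedX convexX f_diff c_diff Cgf_gt0 delta_gt0 gradf_bound
  Q_bound BS B_indep rho_gt1 x1X run f_bound regularity).
Qed.
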